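(* Let $K$ be a field and let $\lambda=(\lambda_1,\ldots,\lambda_m)$ be a partition of a positive integer $n$ with $m\ge 2$ and $\lambda_m>0$. Then the state polytope of the Specht ideal $I_\lambda\subset K[x_1,\ldots,x_n]$ is a generalized permutohedron (i.e. every state polytope of $I_\lambda$ is a generalized permutohedron). In particular, the state polytope of $I_\lambda$ is a (usual) permutohedron, i.e. the permutohedron $\Pi_n$ is a state polytope of $I_\lambda$, if and only if $\lambda_i=\lambda_{i-1}$ for some $2\le i\le m$.
   Context: A partition of $n$ is a non-increasing sequence of non-negative integers with sum $n$. A tableau of shape $\lambda$ is a bijective filling of the boxes of the Young diagram of $\lambda$ by $1,\ldots,n$; $\mathrm{Tab}(\lambda)$ is the set of these. The Specht polynomial $f_T\in S=K[x_1,\ldots,x_n]$ of $T\in\mathrm{Tab}(\lambda)$ is the product of all $x_i-x_j$ such that $i$ and $j$ are in the same column of $T$ and $j$ is in a lower position than $i$. The Specht ideal is $I_\lambda:=\langle f_T\mid T\in\mathrm{Tab}(\lambda)\rangle\subset S$ (a homogeneous ideal). For a nonzero homogeneous ideal $I\subset S$ and $\mathbf{w}\in\mathbb{R}^n$, $\operatorname{in}_{\mathbf{w}}(I)$ is the ideal generated by the initial forms $\operatorname{in}_{\mathbf{w}}(f)$, $f\in I$, where $\operatorname{in}_{\mathbf{w}}(f)$ is the sum of the terms $c\,x_1^{a_1}\cdots x_n^{a_n}$ of $f$ for which $(a_1,\ldots,a_n)\cdot\mathbf{w}$ is maximal. Put $C[\mathbf{w}]:=\{\mathbf{w}'\in\mathbb{R}^n\mid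 \operatorname{in}_{\mathbf{w}}(I)=\operatorname{in}_{\mathbf{w}'}(I)\}$. The Gröbner fan of $I$ is $\mathrm{GF}(I):=\{\overline{C[\mathbf{w}]}\mid \mathbf{w}\in\mathbb{R}^n\}$ (closures); it is a complete fan. A convex polytope $P\subset\mathbb{R}^n$ is a state polytope of $I$ if $\mathrm{GF}(I)$ is the normal fan of $P$, where the normal fan consists of the cones of all $\mathbf{w}$ that are maximized over $P$ on (at least) a given face. Every homogeneous ideal has a state polytope, and any two have the same normal fan. The permutohedron $\Pi_n$ of order $n$ is the convex hull of $\{(\sigma(1),\ldots,\sigma(n))\mid\sigma\in\mathfrak{S}_n\}\subset\mathbb{R}^n$, where $\mathfrak{S}_n$ is the $n$-th symmetric group. The braid fan $\mathrm{Br}_n$ is the complete fan in $\mathbb{R}^n$ given by the hyperplanes $x_i-x_j=0$ for all $i\neq j$. A generalized permutohedron is a polytope obtained by moving the vertices of a permutohedron while keeping the same edge directions; equivalently, a polytope $P\subset\mathbb{R}^n$ whose normal fan is refined by $\mathrm{Br}_n$. *)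

(* Defs.v *)
From mathcomp Require Import all_boot all_order all_fingroup all_algebra.
From mathcomp Require Import boolp classical_sets functions cardinality reals.
From mathcomp Require Import topology normedtype.
(* The reserved notations of mpoly clash with those of mathcomp-analysis. *)
From mathcomp Require Import -(notations) mpoly.

Set Implicit Arguments.
Unset Strict Implicit.
Unset Printing Implicit Defensive.

Import Order.TTheory GRing.Theory Num.Theory.
Import numFieldNormedType.Exports.

Local Open Scope classical_set_scope.
Local Open Scope ring_scope.

(* (i; j) is the box in row i and column j, both counted from 0. *)
Definition young_box (lam : seq nat) : finType :=
  {i : 'I_(size lam) & 'I_(nth 0%N lam i)}.

Definition is_tableau (n : nat) (lam : seq nat) (T : young_box lam -> 'I_n) :
  Prop := bijective T.

Definition specht_poly (K : fieldType) (n : nat) (lam : seq nat)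
    (T : young_box lam -> 'I_n) : mpoly n K :=
  \prod_(b : young_box lam)
    \prod_(c : young_box lam |
        (tagged b == tagged c :> nat) && (tag b < tag c)%N)
      (mpolyX K (mnm1 (T b)) - mpolyX K (mnm1 (T c))).

Definition ideal_gen (A : comNzRingType) (G : set A) : set A :=
  [set f | exists (k : nat) (a g : 'I_k -> A),
    (forall i, G (g i)) /\ f = \sum_i a i * g i].

Definition specht_ideal (K : fieldType) (n : nat) (lam : seq nat) :
    set (mpoly n K) :=
  ideal_gen [set f | exists T : young_box lam -> 'I_n,
    is_tableau T /\ f = specht_poly K T].

Arguments specht_ideal K n lam : clear implicits.

Section GroebnerFan.
Variables (R : realType) (K : fieldType) (n : nat).
Implicit Types (w : 'rV[R]_n) (f : mpoly n K) (I : set (mpoly n K)).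

Definition weight w (m : multinom n) : R := \sum_i (m i)%:R * w 0 i.

Definition initial_form w f : mpoly n K :=
  \sum_(m <- msupp f | all (fun m' => weight w m' <= weight w m) (msupp f))
    mcoeff m f *: mpolyX K m.

Definition initial_ideal w I : set (mpoly n K) :=
  ideal_gen (initial_form w @` I).

Definition groebner_cell I w : set 'rV[R]_n :=
  [set w' | initial_ideal w I = initial_ideal w' I].

Definition groebner_fan I : set (set 'rV[R]_n) :=
  [set closure (groebner_cell I w) | w in [set: 'rV[R]_n]].

End GroebnerFan.

Arguments groebner_fan R [K n] I.

Section Polytopes.
Variables (R : realType) (n : nat).
Implicit Types (w x : 'rV[R]_n) (P F : set 'rV[R]_n).
Implicit Types (G H : set (set 'rV[R]_n)).

Definition dotp w x : R := \sum_i w 0 i * x 0 i.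

Definition conv_hull (A : set 'rV[R]_n) : set 'rV[R]_n :=
  [set x | exists (k : nat) (c : 'I_k -> R) (p : 'I_k -> 'rV[R]_n),
    [/\ forall i, A (p i), forall i, 0 <= c i, \sum_i c i = 1 &
        x = \sum_i c i *: p i]].

Definition polytope P : Prop :=
  exists A, [/\ finite_set A, A !=set0 & P = conv_hull A].

Definition argmax_face P w : set 'rV[R]_n :=
  [set x | P x /\ forall y, P y -> dotp w y <= dotp w x].

(* For a polytope the nonempty faces, including P itself (w = 0), are exactly
   the sets of maximizers of linear functionals. *)
Definition face P F : Prop := exists w, F = argmax_face P w.

Definition normal_cone P F : set 'rV[R]_n := [set w | F `<=` argmax_face P w].

Definition normal_fan P : set (set 'rV[R]_n) :=
  [set normal_cone P F | F in face P].

Definition braid_cell w : set 'rV[R]_n :=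
  [set w' | forall i j, Num.sg (w' 0 i - w' 0 j) = Num.sg (w 0 i - w 0 j)].

(* The cones of the fan of an arrangement are the closures of the cells on
   which the position with respect to each hyperplane is constant. *)
Definition braid_fan : set (set 'rV[R]_n) :=
  [set closure (braid_cell w) | w in [set: 'rV[R]_n]].

Definition refines G H : Prop :=
  \bigcup_(C in G) C = \bigcup_(D in H) D /\
  forall C, G C -> exists D, H D /\ C `<=` D.

Definition generalized_permutohedron P : Prop :=
  polytope P /\ refines braid_fan (normal_fan P).

(* The entries of 'I_n start at 0, whence the successor. *)
Definition permutohedron : set 'rV[R]_n :=
  conv_hull [set \row_i (s i).+1%:R | s in [set: {perm 'I_n}]].

Definition state_polytope (K : fieldType) (I : set (mpoly n K)) P : Prop :=
  polytope P /\ groebner_fan R I = normal_fan P.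

End Polytopes.

Arguments permutohedron R n : clear implicits.
Arguments braid_fan R n : clear implicits.

(* Main.v *)
Require Import Defs.
From mathcomp Require Import all_boot all_order all_fingroup all_algebra.
From mathcomp Require Import boolp classical_sets cardinality reals.
From mathcomp Require Import topology normedtype.
From mathcomp Require Import zify ring lra.
From mathcomp Require Import -(notations) mpoly.

Set Implicit Arguments.
Unset Strict Implicit.
Unset Printing Implicit Defensive.

Import Order.TTheory GRing.Theory Num.Theory.
Import numFieldNormedType.Exports.

(** Let beta be the list of the column heights of lam. A coloring c of the
    variables by columns gives the product vdm c of the differences of variables
    of the same color; up to sign, the Specht polynomials of shape lam are the
    vdm c whose class sizes are beta. More generally vdm c is in the Specht ideal
    I as soon as the shape of c is dominated by lam (specht_ideal_vdm): Lagrange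
    interpolation expresses vdm c by products in which one box has been moved to
    a lower column. For an order s of the variables, the leading monomial of
    vdm c is the product of the x ^ height, where the height of x is its
    position among the variables of its color.

    These products form a universal Groebner basis. Let e be the lexicographic
    leading exponent of a nonzero f, and place the variables one by one, by
    increasing rank, each in the highest column that is at most as high as its
    exponent. The resulting shape nu has a product whose leading monomial
    divides that of f. Choosing coordinates one at a time among the most frequent
    values so far, one finds a point where f does not vanish and whose
    multiplicities dominate nu (nonvanishing). But an element of I vanishes at
    points whose multiplicities are not dominated by lam (specht_ideal_vanish).
    So nu is dominated by lam if f is in I, and the standard monomials, those
    divisible by no leading monomial, are independent modulo I (std_zero). It
    follows that in_w(I) is generated by the initial forms of the vdm c, which
    only depend on the signs of the w_i - w_j (initial_ideal_gen): the braid fan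
    refines the Groebner fan, which is the first claim.

    By the rearrangement inequality the normal fan of the permutohedron is the
    braid fan (normal_fan_permutohedron). So the second claim asks when the
    Groebner cells are the braid cells. Groebner cells are convex: if one of them
    is too large, then for some order of the variables two neighbours can be
    exchanged without changing the standard monomials (swap_reducible). When two
    rows of lam are equal, say the rows t and t + 1, no column has height t, and
    for every order and every pair of neighbours some coloring has a leading
    monomial that is not one after the exchange (gap_detects): exchanging two
    variables stacked in a column makes the greedy filling put too many boxes in
    the first rows. When all rows are distinct, every height up to the largest
    one occurs, and the two largest variables can always be exchanged
    (no_gap_swap), so that some Groebner cell meets two braid chambers. *)

(** * Column heights and dominance *)

Section Heights.
Variable n : nat.
Implicit Types (h g : 'I_n -> nat) (k : nat).

(** The number of boxes in the first k rows of a diagram whose columns have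
    heights h, in any order: the partial sum of row lengths that the dominance
    order compares, without sorting the columns. *)
Definition cap h k := \sum_j minn (h j) k.

Definition dominated h g := forall k, cap h k <= cap g k.

Lemma cap_incr h g a k :
  (forall j, g j = h j + (a == j)) -> cap g k = cap h k + (h a < k).
Proof.
move=> gE; rewrite /cap (bigD1 a) //= [in RHS](bigD1 a) //= gE eqxx.
rewrite (eq_bigr (fun j => minn (h j) k)); last first.
  by move=> j ja; rewrite gE eq_sym (negbTE ja) addn0.
lia.
Qed.

(** The second difference of cap h counts columns: cap h is concave, and it is
    affine exactly around the values that are not column heights. *)
Lemma cap_second_diff h k :
  cap h k + cap h k.+2 + \sum_j (h j == k.+1) = 2 * cap h k.+1.
Proof.
rewrite /cap big_distrr -!big_split /=; apply: eq_bigr => j _.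
by case: eqP => /=; lia.
Qed.

Lemma cap_concave h k : cap h k + cap h k.+2 <= 2 * cap h k.+1.
Proof. by have := cap_second_diff h k; lia. Qed.

Lemma cap0 h : cap h 0 = 0.
Proof. by rewrite /cap big1 // => j _; rewrite minn0. Qed.

Lemma cap_ge_heights h k : (forall j, h j <= k) -> cap h k = \sum_j h j.
Proof. by move=> hk; apply: eq_bigr => j _; apply/minn_idPl. Qed.

Lemma cap_lt_next h k j : k < h j -> cap h k < cap h k.+1.
Proof.
move=> kh; rewrite /cap (bigD1 j) //= [ltnRHS](bigD1 j) //= -addSn.
by apply: leq_add; [lia | apply: leq_sum => i _; lia].
Qed.

Lemma eq_cap h g : (forall j, h j = g j) -> cap h =1 cap g.
Proof. by move=> e k; apply: eq_bigr => j _; rewrite e. Qed.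

Lemma cap_count_pos h k j : h j = k.+1 -> cap h k + cap h k.+2 < 2 * cap h k.+1.
Proof.
move=> hj; have := cap_second_diff h k; rewrite (bigD1 j) //= hj eqxx; lia.
Qed.

Lemma cap_count_zero h k :
  (forall j, h j != k.+1) -> cap h k + cap h k.+2 = 2 * cap h k.+1.
Proof.
move=> hj; rewrite -cap_second_diff big1 ?addn0 // => j _.
by rewrite (negbTE (hj j)).
Qed.

Lemma count_height_eq h g k : cap h =1 cap g ->
  \sum_j (h j == k) = \sum_j (g j == k).
Proof.
move=> hg; case: k => [|k]; last first.
  by have := cap_second_diff h k; have := cap_second_diff g k; rewrite !hg; lia.
have zeros f : \sum_j (f j == 0) + cap f 1 = n.
  rewrite -big_split /= -[RHS]card_ord -sum1_card; apply: eq_bigr => j _.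
  by case: (f j) => [|m]; rewrite ?min0n // minnSS minn0.
by apply/eqP; rewrite -(eqn_add2r (cap h 1)) {2}hg !zeros.
Qed.

End Heights.

(** On [h, d + 1] the function k |-> S k + (l < k) - M k is concave, nonnegative
    at h and positive at d + 1, hence positive in between. This is the
    monotonicity in the dominance order of the greedy insertion of a box. *)
Lemma concave_step (S M : nat -> nat) (l h d : nat) :
  (forall k, M k <= S k) -> l <= d -> h <= d ->
  (forall k, (S k + (l < k)) + (S k.+2 + (l < k.+2)) <= 2 * (S k.+1 + (l < k.+1))) ->
  (forall k, h <= k < d -> M k + M k.+2 = 2 * M k.+1) ->
  forall k, M k + (h < k) <= S k + (l < k).
Proof.
move=> MS ld hd Sc Ml k; case: (ltnP h k) => [hk|]; last first.
  by move=> _; have := MS k; lia.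
case: (ltnP d k) => dk; first by have := MS k; lia.
pose f j := S j + (l < j).
have slope j : h + j <= d ->
    j.+1 * f (h + j) + j * M (h + j).+1 + M h >= j.+1 * M (h + j) + j * f (h + j).+1 + f h.
  elim: j => [|j IH] hj; first by rewrite addn0; lia.
  have /(leq_mul (leqnn j.+1)) := Sc (h + j).
  have /(congr1 (muln j.+1)) := Ml (h + j) ltac:(lia).
  have := IH ltac:(lia); rewrite !addnS -/(f _) -/(f _.+2) -/(f _.+1).
  move: (f (h + j)) (f (h + j).+1) (f (h + j).+2) (M (h + j)) => f0 f1 f2 m0.
  move: (M (h + j).+1) (M (h + j).+2) => m1 m2.
  rewrite !mulSn !mulnDr => *; lia.
have pos j : h < j <= d.+1 -> M j < f j.
  move=> /andP[hj jd].
  have [i ji] : exists i, j = d.+1 - i by exists (d.+1 - j); lia.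
  move: hj; rewrite {j jd}ji; elim: i => [|i IH] hi.
    by rewrite subn0 /f; have := MS d.+1; lia.
  have := IH ltac:(lia).
  have [j hj] : exists j, d.+1 - i.+1 = h + j.+1 by exists (d.+1 - i.+1 - h.+1); lia.
  have -> : d.+1 - i = (h + j.+1).+1 by lia.
  rewrite hj; have := slope j.+1 ltac:(lia); have := MS h; rewrite /f; nia.
by have := pos k ltac:(lia); rewrite /f; lia.
Qed.

Section Colorings.
Variable n : nat.
Implicit Types (s : {perm 'I_n}) (c : 'I_n -> 'I_n) (e : 'I_n -> nat).

(** A permutation s orders the variables by the rank s x, and c x is the column
    that receives x when the variables are placed one by one by increasing
    rank, each on top of the boxes already in its column. *)
Definition filled s c (i : nat) (j : 'I_n) := \sum_(x | s x < i) (c x == j).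
Definition height s c x := filled s c (s x) (c x).
Definition class_size c j := \sum_x (c x == j).

Lemma filled_full s c j : filled s c n j = class_size c j.
Proof. by apply: eq_bigl => x; rewrite ltn_ord. Qed.

Lemma filled0 s c j : filled s c 0 j = 0.
Proof. by rewrite /filled big_pred0. Qed.

Lemma filledS s c x j :
  filled s c (s x).+1 j = filled s c (s x) j + (c x == j).
Proof.
rewrite /filled (bigD1 x) //= addnC; congr (_ + _); apply: eq_bigl => y.
by rewrite ltnS [in RHS]ltn_neqAle (inj_eq val_inj) (inj_eq perm_inj) andbC.
Qed.

Lemma eq_filled s s' c c' i j :
  (forall x, (s x < i) = (s' x < i)) -> (forall x, s x < i -> c x = c' x) ->
  filled s c i j = filled s' c' i j.
Proof.
move=> es ec; rewrite /filled -(eq_bigl _ _ es).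
by apply: eq_bigr => x sx; rewrite ec.
Qed.

Lemma sum_filled s c i : i <= n -> \sum_j filled s c i j = i.
Proof.
move=> ilen; rewrite /filled exchange_big /=.
rewrite (eq_bigr (fun _ => 1)); last first.
  move=> x _; rewrite (bigD1 (c x)) //= eqxx big1 // => j.
  by rewrite eq_sym => /negbTE->.
rewrite -[RHS](card_ord i) -sum1_card (big_ord_widen n (fun=> 1)) //.
by rewrite [RHS](reindex_inj (@perm_inj _ s)).
Qed.

Lemma empty_color s c i : i < n -> exists j, filled s c i j = 0.
Proof.
move=> lin; have /existsP[j /eqP] : [exists j, filled s c i j == 0].
  apply: contraLR (lin); rewrite negb_exists -leqNgt => /forallP no.
  rewrite -[leqRHS](sum_filled s c (ltnW lin)) -[leqLHS](card_ord n) -sum1_card.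
  by apply: leq_sum => j _; rewrite lt0n no.
by exists j.
Qed.

Lemma cap_filledS s c x k :
  cap (filled s c (s x).+1) k = cap (filled s c (s x)) k + (height s c x < k).
Proof. by apply: cap_incr => j; rewrite filledS. Qed.

(** Induction on the number of variables placed, naming the variable x that is
    placed next. *)
Lemma stage_ind (P : nat -> Prop) s :
  P 0 -> (forall x, P (s x) -> P (s x).+1) -> forall i, i <= n -> P i.
Proof.
move=> P0 PS; elim=> [//|i IH] lin.
have := PS ((s^-1)%g (Ordinal lin)); rewrite permKV /=; apply.
by apply: IH; apply: ltnW.
Qed.

Lemma cap_filled s c k i : i <= n ->
  cap (filled s c i) k = \sum_(x | s x < i) (height s c x < k).
Proof.
move: i; apply: (stage_ind (s:=s)) => [|x IH].
  by rewrite big_pred0 // /cap big1 // => j _; rewrite filled0 min0n.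
rewrite cap_filledS IH [RHS](bigD1 x) //= addnC; congr (_ + _).
apply: eq_bigl => y.
by rewrite [RHS]andbC ltnS ltn_neqAle (inj_eq val_inj) (inj_eq perm_inj).
Qed.

Lemma cap_class_size s c k : cap (class_size c) k = \sum_x (height s c x < k).
Proof.
rewrite (@eq_cap _ _ (filled s c n)) => [|j]; last by rewrite filled_full.
by rewrite cap_filled //; apply: eq_bigl => x; rewrite ltn_ord.
Qed.

(** Each variable x goes to a column as high as possible among those of height
    at most e x; then x ^ e is divisible by the product of the x ^ height. *)
Definition greedy_at s e c x := height s c x <= e x /\
  forall j, filled s c (s x) j <= e x -> filled s c (s x) j <= height s c x.
Definition greedy s e c := forall x, greedy_at s e c x.

(** There are as many colors as variables, so at every step some column is empty
    and admissible. *)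
Lemma greedy_exists s e : exists c, greedy s e c.
Proof.
suff /(_ n (leqnn n)) [c cg] : forall i, i <= n ->
    exists c, forall x, s x < i -> greedy_at s e c x.
  by exists c => x; apply: cg.
apply: (stage_ind (s:=s)) => [|y [c IH]]; first by exists id.
have [j0 j00] := empty_color s c (ltn_ord (s y)).
pose P j := filled s c (s y) j <= e y.
have Pj0 : P j0 by rewrite /P j00.
case: (arg_maxnP (filled s c (s y)) Pj0) => j Pj jmax.
pose c' x := if x == y then j else c x.
have cE x : s x < s y -> c' x = c x.
  by rewrite /c'; case: eqP => [->|]; rewrite ?ltnn.
have fE i k : i <= s y -> filled s c' i k = filled s c i k.
  by move=> iy; apply: eq_filled => // x xi; apply: cE; apply: leq_trans iy.
exists c' => x; rewrite ltnS leq_eqVlt => /orP[/eqP/val_inj/perm_inj ->|xy].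
  have hE : height s c' y = filled s c (s y) j by rewrite /height /c' eqxx fE.
  by split=> [|k]; rewrite hE // fE // => /jmax.
have [h1 h2] := IH x xy; rewrite /greedy_at /height cE // (fE _ _ (ltnW xy)).
by split=> // k; rewrite fE ?(ltnW xy) //; apply: h2.
Qed.

(** No column height lies strictly between the height chosen for x and e x. *)
Lemma greedy_linear s e c x k : greedy_at s e c x -> height s c x <= k < e x ->
  cap (filled s c (s x)) k + cap (filled s c (s x)) k.+2 =
    2 * cap (filled s c (s x)) k.+1.
Proof.
move=> [_ gx] /andP[hk ke]; apply: cap_count_zero => j; apply/eqP => jk.
by have := gx j; rewrite jk => /(_ ke); rewrite ltnNge hk.
Qed.

(** If S bounds the greedy filling and stays concave when a box is added in row
    l <= e x, the bound survives the next greedy step. *)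
Lemma greedy_step s e c x (S : nat -> nat) l : greedy_at s e c x ->
  (forall k, cap (filled s c (s x)) k <= S k) -> l <= e x ->
  (forall k, (S k + (l < k)) + (S k.+2 + (l < k.+2)) <= 2 * (S k.+1 + (l < k.+1))) ->
  forall k, cap (filled s c (s x).+1) k <= S k + (l < k).
Proof.
move=> gx le_S le_l conc k; rewrite cap_filledS.
apply: (concave_step (d := e x)) => //; first by case: gx.
by move=> k' hk'; apply: greedy_linear gx hk'.
Qed.

(** The greedy filling is the smallest one in the dominance order among the
    fillings whose heights are bounded by e. *)
Lemma greedy_dominated s e c c0 i : i <= n ->
  (forall x, s x < i -> greedy_at s e c x) ->
  (forall x, s x < i -> height s c0 x <= e x) ->
  forall k, cap (filled s c i) k <= cap (filled s c0 i) k.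
Proof.
move: i; apply: (stage_ind (s:=s)) => [_ _ k|x IH gc c0e k].
  by rewrite (eq_cap (filled0 s c)) (eq_cap (filled0 s c0)).
rewrite [leqRHS]cap_filledS; apply: greedy_step; first exact: gc.
- by apply: IH => y yx; [apply: gc | apply: c0e]; apply: ltnW.
- exact: c0e.
- by move=> k'; rewrite -!cap_filledS cap_concave.
Qed.

End Colorings.

(** The rank of x is the number of its predecessors. *)
Lemma perm_of_order n (lt : rel 'I_n) :
  irreflexive lt -> transitive lt -> (forall x y, x != y -> lt x y || lt y x) ->
  exists s : {perm 'I_n}, forall x y, (s x < s y) = lt x y.
Proof.
move=> irr tr tot; pose rk x := #|[pred z | lt z x]|.
have rk_lt x : rk x < n.
  rewrite -[ltnRHS]card_ord; apply: proper_card.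
  by apply/properP; split; [apply/fintype.subsetP | exists x; rewrite // !inE irr].
have rk_mono x y : lt x y -> rk x < rk y.
  move=> xy; apply: proper_card; apply/properP; split; last by exists x; rewrite !inE ?irr.
  by apply/fintype.subsetP => z; rewrite !inE => /tr; apply.
have rk_inj : injective (fun x => Ordinal (rk_lt x)).
  move=> x y /(congr1 val) /= rkxy; apply/eqP; apply: contraT => /tot.
  by case/orP => /rk_mono; rewrite rkxy ltnn.
exists (perm rk_inj) => x y; rewrite !permE /=.
apply/idP/idP => [rkxy|/rk_mono //].
have : x != y by apply: contraTneq rkxy => ->; rewrite ltnn.
by case/tot/orP => // /rk_mono; rewrite ltnNge ltnW.
Qed.

(** * Detecting the exchange of two adjacent variables *)

Section Certificate.
Variable n : nat.
Implicit Types (s : {perm 'I_n}) (c : 'I_n -> 'I_n) (e : 'I_n -> nat).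

Lemma swap_ltn s a b x i : (s b).+1 = s a :> nat -> i <= s b ->
  ((tperm a b * s)%g x < i) = (s x < i).
Proof. by move=> sab ib; rewrite permM; case: tpermP => [->|->|//]; lia. Qed.

Lemma swap_val s a b x : (s b).+1 = s a :> nat -> s x < s b -> (tperm a b * s)%g x = s x.
Proof. by move=> sab; rewrite permM; case: tpermP => [->|->|//]; lia. Qed.

(** Let b and a be neighbours in the order s, stacked in the same column at
    heights r and r + 1, while no other column met at this stage has a height
    in [k, r + 1]. If a is placed before b, the greedy filling puts a at height
    r and then b below height k, or already a below height k when r < k. So it
    has more boxes in the first k rows than c does, which is impossible when c
    attains the bound there. *)
Lemma swap_not_dominated s a b c c' (beta : 'I_n -> nat) k (r := height s c b) :
  (s b).+1 = s a :> nat -> c a = c b -> 0 < k <= r.+1 ->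
  (forall j, j != c b -> (filled s c (s b) j < k) || (r.+1 < filled s c (s b) j)) ->
  cap (class_size c) k = cap beta k ->
  greedy (tperm a b * s)%g (height s c) c' -> ~ dominated (class_size c') beta.
Proof.
move=> sab cab /andP[k0 kr] out tight gc'; set s3 := (_ * _)%g in gc' *.
set p := s b in sab out *; pose e := height s c.
have ab : a != b by apply/eqP => ab; rewrite ab in sab; rewrite /p in sab; lia.
have s3a : s3 a = p by rewrite permM tpermL.
have s3b : s3 b = s a by rewrite permM tpermR.
have ea : e a = r.+1.
  by rewrite /e /height -sab filledS cab eqxx addn1.
have fE i j : i <= p -> filled s3 c i j = filled s c i j.
  by move=> ip; apply: eq_filled => // x; apply: swap_ltn.
pose F := filled s c p; pose F' := filled s3 c' p.
have pn : p <= n by apply: ltnW.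
have le' x : height s3 c' x <= e x by case: (gc' x).
have capF k' : cap F' k' = cap F k'.
  apply/eqP; rewrite eqn_leq; apply/andP; split.
    rewrite -(eq_cap (fun j => fE p j (leqnn _))).
    apply: (greedy_dominated (e := e)) => // x; rewrite swap_ltn // => xp.
    by rewrite /height swap_val // fE // ltnW.
  rewrite /F' cap_filled // cap_filled // (eq_bigl _ _ (fun x => swap_ltn x sab (leqnn p))).
  by apply: leq_sum => x _; have := le' x; rewrite /e; lia.
move=> dom.
have same x : (height s3 c' x < k) = (e x < k).
  have := dom k; rewrite -tight (cap_class_size s3 c') (cap_class_size s c) => le.
  have ge y : (e y < k) <= (height s3 c' y < k) by have := le' y; lia.
  have : \sum_y (height s3 c' y < k) == \sum_y (e y < k).
    by rewrite eqn_leq (le : _ <= _); apply: leq_sum => y _; apply: ge.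
  rewrite (bigD1 x) //= [X in _ == X](bigD1 x) //=.
  have : \sum_(i | i != x) (e i < k) <= \sum_(i | i != x) (height s3 c' i < k).
    by apply: leq_sum => y _; apply: ge.
  have := ge x; move: (\sum_(i | _) _) (\sum_(i | _) _) => A B.
  by case: (e x < k); case: (height s3 c' x < k); lia.
have onlyA h j : k <= h <= r.+1 -> F j = h -> j = c b.
  by move=> hk Fj; apply/eqP; apply: contraT => /out; rewrite -/(F j) Fj; lia.
(* Up to the step p the two fillings have the same heights, so F' meets the range
   [k, r + 1] at most once, in height r. *)
have in_range j' : k <= F' j' <= r.+1 -> F' j' = r.
  move=> hk; have h0 : 0 < F' j' by lia.
  have := count_height_eq (F' j') capF; rewrite (bigD1 j') //= eqxx => cnt.
  have /existsP[j /eqP Fj] : [exists j, F j == F' j'].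
    apply: contraT; rewrite negb_exists => /forallP no.
    by move: cnt; rewrite [RHS]big1 // => j _; rewrite (negbTE (no j)).
  by rewrite -Fj (onlyA _ _ hk Fj).
have ha : height s3 c' a = F' (c' a) by rewrite /height s3a.
have rE : F' (c' a) = r.
  apply: in_range; rewrite -ha; have := same a; have := le' a; rewrite ea.
  by lia.
have kr' : k <= r by have := same a; rewrite ea ha rE; lia.
have hb : height s3 c' b = F' (c' b) + (c' a == c' b).
  by rewrite /height s3b -sab -s3a filledS s3a.
have := le' b; have := same b; rewrite hb -[e b]/r => sb leb.
move: sb leb; have [cc|cc] := eqVneq (c' a) (c' b); first by rewrite -cc rE; lia.
rewrite addn0 => sb leb.
have rbE : F' (c' b) = r by apply: in_range; lia.
have le1 : \sum_j (F j == r) <= 1.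
  rewrite (bigD1 (c b)) //= big1 ?addn0 ?leq_b1 // => j jb.
  have [Fj|//] := eqVneq (F j) r; case/eqP: jb; apply: onlyA Fj.
  by rewrite kr' leqnSn.
move: le1; have r0 : 0 < r by lia.
have := count_height_eq r capF => <-.
rewrite (bigD1 (c' a)) //= rE eqxx (bigD1 (c' b)) /=; last by rewrite eq_sym.
by rewrite rbE eqxx.
Qed.

Definition seq_coloring s (d : 'I_n) (cs : seq 'I_n) x := nth d cs (s x).

Lemma filled_seq s d cs i j : size cs = n -> i <= n ->
  filled s (seq_coloring s d cs) i j = count_mem j (take i cs).
Proof.
move=> csn; move: i; apply: (stage_ind (s := s)) => [|x IH].
  by rewrite filled0 take0.
by rewrite filledS IH (take_nth d) ?csn // -cats1 count_cat /= addn0.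
Qed.

Lemma class_size_seq s d cs j : size cs = n ->
  class_size (seq_coloring s d cs) j = count_mem j cs.
Proof. by move=> csn; rewrite -(filled_full s) filled_seq // take_oversize ?csn. Qed.

(** A certificate that exchanging the neighbours a and b changes the set of
    leading monomials: that of vdm c is not reducible for the other order. *)
Definition detects s a b (beta : 'I_n -> nat) := exists c,
  dominated (class_size c) beta /\
  forall c', greedy (tperm a b * s)%g (height s c) c' -> ~ dominated (class_size c') beta.

(** The variables b and a are read inside a block of color A, whose first r
    entries have already been read together with u. *)
Lemma detects_seq s a b beta (u v : seq 'I_n) A h r k :
  (s b).+1 = s a :> nat -> s b = size u + r :> nat -> r.+1 < h -> 0 < k <= r.+1 ->
  size (u ++ nseq h A ++ v) = n -> A \notin u ->
  (forall j, j != A -> (count_mem j u < k) || (r.+1 < count_mem j u)) ->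
  (forall k', cap (fun j => count_mem j (u ++ nseq h A ++ v)) k' <= cap beta k') ->
  cap (fun j => count_mem j (u ++ nseq h A ++ v)) k = cap beta k ->
  detects s a b beta.
Proof.
set cs := (u ++ _) => sab sb rh kr csn Au out dom tight.
pose c := seq_coloring s A cs.
have nthA i : size u <= i < size u + h -> nth A cs i = A.
  move=> /andP[ui ih]; rewrite nth_cat ltnNge ui /= nth_cat size_nseq.
  by rewrite ltn_subLR // ih nth_nseq ltn_subLR // ih.
have cb : c b = A by rewrite /c /seq_coloring nthA // sb; lia.
have ca : c a = A by rewrite /c /seq_coloring nthA // -sab sb; lia.
have tkE : take (s b) cs = u ++ nseq r A.
  rewrite sb take_cat ltnNge leq_addr /= addKn takel_cat ?size_nseq; last by lia.
  congr (_ ++ _); rewrite -{1}(@subnK r h); last by lia.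
  by rewrite addnC nseqD take_size_cat ?size_nseq.
have fE j : filled s c (s b) j = count_mem j u + (A == j) * r.
  by rewrite filled_seq // ?tkE ?count_cat ?count_nseq // ltnW.
have hb : height s c b = r.
  by rewrite /height cb fE eqxx mul1n; rewrite (count_memPn Au).
have szE : cap (class_size c) =1 cap (fun j => count_mem j cs).
  by apply: eq_cap => j; apply: class_size_seq.
exists c; split=> [k'|c' gc']; first by rewrite szE.
apply: (swap_not_dominated (k := k) sab _ _ _ _ gc'); rewrite ?ca ?cb ?hb //.
  by move=> j jA; rewrite fE eq_sym (negbTE jA) addn0 out.
by rewrite szE.
Qed.

End Certificate.

(** * A missing column height *)

Section GapDetects.
Variable n : nat.
Implicit Types (s : {perm 'I_n}) (g : 'I_n -> nat) (P : pred 'I_n).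

Definition blocks g P := flatten [seq nseq (g j) j | j <- enum 'I_n & P j].

Lemma count_blocks g P j : count_mem j (blocks g P) = if P j then g j else 0.
Proof.
rewrite /blocks count_flatten -map_comp sumnE big_map big_filter /= big_enum_cond /=.
rewrite big_mkcond (bigD1 j) //= count_nseq /= eqxx mul1n big1 ?addn0 // => i /negbTE ij.
by rewrite count_nseq /= ij if_same.
Qed.

Lemma size_blocks g P : size (blocks g P) = \sum_(j | P j) g j.
Proof.
rewrite /blocks size_flatten /shape -map_comp sumnE big_map big_filter /= big_enum_cond /=.
by apply: eq_bigr => j _; rewrite /= size_nseq.
Qed.

Lemma sum_split g (A : 'I_n) :
  \sum_j g j = \sum_(j : 'I_n | j < A) g j + (g A + \sum_(j : 'I_n | A < j) g j).
Proof.
rewrite (bigID (fun j : 'I_n => j < A)) /= [X in _ + X](bigD1 A) ?ltnn //=.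
congr (_ + (_ + _)); apply: eq_bigl => j; rewrite -leqNgt -(inj_eq val_inj) /=; lia.
Qed.

Lemma detects_blocks s a b (beta g : 'I_n -> nat) (A : 'I_n) r k :
  \sum_j g j = n -> (s b).+1 = s a :> nat ->
  s b = \sum_(j : 'I_n | j < A) g j + r :> nat -> r.+1 < g A -> 0 < k <= r.+1 ->
  (forall j : 'I_n, j < A -> (g j < k) || (r.+1 < g j)) ->
  dominated g beta -> cap g k = cap beta k -> detects s a b beta.
Proof.
move=> gn sab sb rA kr out dom tight.
pose u := blocks g (fun j => j < A); pose v := blocks g (fun j => A < j).
have cE j : count_mem j (u ++ nseq (g A) A ++ v) = g j.
  rewrite !count_cat count_nseq !count_blocks /= eq_sym -(inj_eq val_inj) /=.
  by case: ltngtP => [||/val_inj->] /=; lia.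
apply: (@detects_seq _ s a b beta u v A (g A) r k) => //.
- by rewrite size_blocks.
- by rewrite !size_cat size_nseq !size_blocks -sum_split.
- by rewrite -has_pred1 has_count count_blocks ltnn.
- move=> j _; rewrite count_blocks; case: ifP => [/out //|_]; lia.
- by move=> k'; rewrite (eq_cap cE).
- by rewrite (eq_cap cE).
Qed.

Lemma find_block g p : p < \sum_j g j ->
  exists (A : 'I_n) r, p = \sum_(j : 'I_n | j < A) g j + r /\ r < g A.
Proof.
move=> pg; suff : forall m, m <= n -> p < \sum_(j : 'I_n | j < m) g j ->
    exists (A : 'I_n) r, p = \sum_(j : 'I_n | j < A) g j + r /\ r < g A.
  by apply; [exact: leqnn | under eq_bigl do rewrite ltn_ord].
elim=> [_|m IH mn]; first by rewrite big_pred0.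
pose A := Ordinal mn.
have -> : \sum_(j : 'I_n | j < m.+1) g j = \sum_(j : 'I_n | j < A) g j + g A.
  rewrite (bigD1 A) //= addnC; congr (_ + _); apply: eq_bigl => j.
  by rewrite -(inj_eq val_inj) /=; lia.
case: (ltnP p (\sum_(j : 'I_n | j < A) g j)) => [lt _|le lt]; first exact: IH (ltnW mn) lt.
by exists A, (p - \sum_(j : 'I_n | j < A) g j); rewrite subnKC // ltn_subLR.
Qed.

(** Call a column tall if its height exceeds t. As t is not a height, the short
    columns are lower than t, so they never matter for k = t, and the bound at t
    is kept by moves of boxes among the tall columns that leave them of height
    at least t. It remains to read the columns in such an order that b and a
    fall into the same column. *)
Lemma gap_detects s a b (beta : 'I_n -> nat) t :
  \sum_j beta j = n -> (forall i j : 'I_n, i <= j -> beta j <= beta i) ->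
  0 < t -> (forall j, beta j != t) -> (exists j, t < beta j) ->
  (s b).+1 = s a :> nat -> detects s a b beta.
Proof.
move=> bn mono t0 gap [j0 tj0] sab; have san := ltn_ord (s a).
case: (@arg_maxnP _ j0 (fun j => t < beta j) (fun j : 'I_n => j : nat) tj0) => Q tQ Qmax {j0 tj0}.
have short (j : 'I_n) : Q < j -> beta j < t.
  by move=> Qj; rewrite ltn_neqAle gap leqNgt; apply: contraL Qj => /Qmax; rewrite -leqNgt.
have tall (j : 'I_n) : j <= Q -> t < beta j by move=> /mono; apply: leq_trans.
pose E := \sum_(j : 'I_n | j < Q) beta j + beta Q.
have totE : \sum_j beta j = E + \sum_(j : 'I_n | Q < j) beta j.
  by rewrite (sum_split _ Q) addnA.
have [lateE|] := leqP E (s b).+2.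
  (* Late neighbours: x boxes of short columns are read before the last tall
     column Q, at whose end b and a are. *)
  pose S := blocks beta (fun j => Q < j); pose x := (s b).+2 - E.
  pose u := blocks beta (fun j => j < Q) ++ take x S.
  have xS : x <= size S.
    have := totE; rewrite bn size_blocks /x; move: (\sum_(j | _) _) => T; clear -sab san; lia.
  have cE j : count_mem j (u ++ nseq (beta Q) Q ++ drop x S) = beta j.
    rewrite /u !count_cat -addnA [_ + (_ + count _ (drop _ _))]addnCA.
    rewrite -count_cat cat_take_drop count_nseq !count_blocks /= eq_sym -(inj_eq val_inj) /=.
    by case: ltngtP => [||/val_inj->] /=; lia.
  apply: (@detects_seq _ s a b beta u (drop x S) Q (beta Q) (beta Q - 2) t) => //.
  - rewrite size_cat size_takel // size_blocks; move: (tall Q (leqnn _)) lateE.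
    by rewrite /x /E; move: (\sum_(j | _) _) => T; clear -t0; lia.
  - by have := tall Q (leqnn _); lia.
  - by have := tall Q (leqnn _); lia.
  - rewrite !size_cat size_takel // size_drop size_nseq size_blocks.
    have : \sum_(j : 'I_n | j < Q) beta j + beta Q + size S = n by rewrite size_blocks -totE.
    by move: xS; move: (size S) (\sum_(j | _) _) (x) => T T' X; clear; lia.
  - rewrite mem_cat negb_or -!has_pred1 !has_count count_blocks ltnn /=.
    apply: contraTN isT => cnt; have : 0 < count_mem Q S.
      by rewrite -(cat_take_drop x S) count_cat addn_gt0 cnt.
    by rewrite count_blocks ltnn.
  - move=> j jQ; rewrite count_cat count_blocks; have := tall Q (leqnn _).
    case: (ltnP j Q) => jQ'.
      by have := mono _ _ (ltnW jQ'); lia.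
    have lt : Q < j by rewrite ltn_neqAle jQ' eq_sym (inj_eq val_inj) jQ.
    have := short j lt; have : count_mem j (take x S) <= count_mem j S.
      by rewrite -[in leqRHS](cat_take_drop x S) count_cat leq_addr.
    by rewrite count_blocks lt; lia.
  - by move=> k'; rewrite (eq_cap cE).
  - by rewrite (eq_cap cE).
move=> early.
have [|A [r [sb rA]]] := @find_block beta (s b); first by lia.
have AQ : A <= Q.
  rewrite leqNgt; apply/negP => QA; suff : E <= \sum_(j : 'I_n | j < A) beta j by lia.
  rewrite /E [leqRHS](bigID (fun j : 'I_n => j < Q)) /=; apply: leq_add.
    by apply: eq_leq; apply: eq_bigl => j; lia.
  by rewrite (bigD1 Q) ?QA ?ltnn //= leq_addr.
(* The columns of beta are read in order, unless b ends a column. *)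
have [rA1|rA1] := ltnP r.+1 (beta A).
  apply: (@detects_blocks s a b beta beta A r r.+1) => // [|j jA]; first by rewrite leqnn.
  by rewrite (leq_trans rA1) ?orbT // mono // ltnW.
have {}rA : beta A = r.+1 by lia.
have {}AQ : A < Q.
  rewrite ltn_neqAle AQ andbT; apply/eqP => /val_inj AQE.
  by move: early; rewrite /E -AQE rA; lia.
(* Moving a box from the last tall column to the first one shifts the ends of
   the columns in between. *)
have n0 : 0 < n by lia.
pose Z := Ordinal n0.
pose g j := beta j + (Z == j) - (Q == j).
have ZQ : Z != Q by rewrite -(inj_eq val_inj) /=; lia.
have gE j : beta j + (Z == j) = g j + (Q == j).
  by rewrite /g; case: eqP => [<-|]; case: eqP => [<-|]; have := tall Q (leqnn _); lia.
have gQ : t <= g Q by rewrite /g eqxx (negbTE ZQ); have := tall Q (leqnn _); lia.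
have tZ : t < beta Z by apply: tall.
have capE k : cap g k + (g Q < k) = cap beta k + (beta Z < k).
  rewrite -(@cap_incr _ g (fun j => g j + (Q == j)) Q) //.
  by apply: cap_incr => j; rewrite -gE.
have gsum : \sum_j g j = n.
  have one i : \sum_(j : 'I_n) (i == j) = 1.
    by rewrite (bigD1 i) //= eqxx big1 // => j; rewrite eq_sym => /negbTE->.
  have : \sum_j (g j + (Q == j)) = \sum_j (beta j + (Z == j)).
    by apply: eq_bigr => j _; rewrite gE.
  by rewrite !big_split /= !one bn; apply: addIn.
have gA : r.+1 <= g A.
  by rewrite /g rA; case: (Q =P A) => [QA|_]; [rewrite QA ltnn in AQ | lia].
have tA : t < beta A by apply: tall; apply: ltnW.
have sumg : \sum_(j : 'I_n | j < A) beta j + (0 < A) = \sum_(j : 'I_n | j < A) g j.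
  have [A0|A0] := posnP A; first by rewrite !big_pred0 // => j; rewrite A0.
  have -> : \sum_(j : 'I_n | j < A) g j = \sum_(j : 'I_n | j < A) (beta j + (Z == j)).
    apply: eq_bigr => j jA; rewrite gE; case: eqP => [QE|]; last by rewrite addn0.
    by rewrite -QE in jA; lia.
  rewrite big_split /=; congr (_ + _); rewrite (bigD1 Z) //= ?eqxx ?A0 big1 // => j /andP[_].
  by rewrite eq_sym => /negbTE->.
apply: (@detects_blocks s a b beta g A (r - (0 < A)) t) => //.
- by rewrite sb -sumg; lia.
- have [A0|A0] := posnP A; last by rewrite subn1; lia.
  have -> : A = Z by apply: val_inj.
  by rewrite /g eqxx eq_sym (negbTE ZQ) -(_ : A = Z) ?rA //; [lia | apply: val_inj].
- by have := tA; rewrite rA; lia.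
- move=> j jA; apply/orP; right; have := mono _ _ (ltnW jA); rewrite rA => le.
  have : beta j <= g j.
    by rewrite /g; case: (Q =P j) => [QE|_]; [rewrite -QE in jA; lia | lia].
  have -> : 0 < A by lia.
  lia.
- move=> k; have := capE k; have : beta Q <= beta Z by apply: mono.
  have -> : g Q = (beta Q).-1 by rewrite /g eqxx (negbTE ZQ); lia.
  by have := tall Q (leqnn _); lia.
- by have := capE t; lia.
Qed.

End GapDetects.

(** * No missing column height *)

Section NoGap.
Variable n : nat.
Implicit Types (s : {perm 'I_n}) (c : 'I_n -> 'I_n).

Lemma filled_last s c a j : (s a).+1 = n -> filled s c (s a).+1 j = class_size c j.
Proof. by move=> san; apply: eq_bigl => x; rewrite san ltn_ord. Qed.

Lemma cap_last_two s c a b k : (s b).+1 = s a :> nat -> (s a).+1 = n ->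
  cap (class_size c) k =
    cap (filled s c (s b)) k + (height s c b < k) + (height s c a < k).
Proof.
move=> sab san; rewrite -(eq_cap (fun j => filled_last c j san)) cap_filledS.
by rewrite -{1}sab cap_filledS.
Qed.

(** Let b and a be the two largest variables. Only the case where c puts both in
    the same column A is not immediate. Then b moves to the highest other column
    that is not above it. The number of boxes in the first k rows only
    grows where k is not a column height of c; as beta has a column of every
    height up to the largest one, cap beta is strictly concave at k and leaves
    room for one more box. *)
Lemma no_gap_swap s a b c (beta : 'I_n -> nat) :
  (s b).+1 = s a :> nat -> (s a).+1 = n ->
  \sum_j beta j = n ->
  (forall k, 0 < k -> (exists j, k <= beta j) -> exists j, beta j = k) ->
  dominated (class_size c) beta ->
  exists c3, dominated (class_size c3) beta /\
    forall x, height (tperm a b * s)%g c3 x <= height s c x.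
Proof.
move=> sab san bn nogap dom; set s3 := (_ * _)%g.
have ab : a != b by apply/eqP => ab; rewrite ab in sab; lia.
have s3a : s3 a = s b by rewrite permM tpermL.
have s3b : s3 b = s a by rewrite permM tpermR.
pose F := filled s c (s b).
pose c3 A1 A2 x := if x == a then A1 else if x == b then A2 else c x.
have c3a A1 A2 : c3 A1 A2 a = A1 by rewrite /c3 eqxx.
have c3b A1 A2 : c3 A1 A2 b = A2 by rewrite /c3 eq_sym (negbTE ab) eqxx.
have c3E A1 A2 x : s x < s b -> c3 A1 A2 x = c x.
  by rewrite /c3; case: eqP => [->|_]; [lia | case: eqP => [->|//]; rewrite ltnn].
have fE A1 A2 i j : i <= s b -> filled s3 (c3 A1 A2) i j = filled s c i j.
  move=> ib; apply: eq_filled => [x|x]; first exact: swap_ltn.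
  by rewrite swap_ltn // => xi; apply: c3E; apply: leq_trans ib.
have h3a A1 A2 : height s3 (c3 A1 A2) a = F A1 by rewrite /height c3a s3a fE.
have h3b A1 A2 : height s3 (c3 A1 A2) b = F A2 + (A1 == A2).
  by rewrite /height c3b s3b -sab -s3a filledS s3a fE // c3a.
have h3E A1 A2 x : x != a -> x != b -> height s3 (c3 A1 A2) x = height s c x.
  move=> xa xb; have xsb : s x < s b.
    have := ltn_ord (s x); have : s x != s a :> nat by rewrite (inj_eq val_inj) (inj_eq perm_inj).
    have : s x != s b :> nat by rewrite (inj_eq val_inj) (inj_eq perm_inj).
    by lia.
  by rewrite /height c3E // swap_val // fE // ltnW.
have ha : height s c a = F (c a) + (c b == c a) by rewrite /height -sab filledS.
have hb : height s c b = F (c b) by [].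
have le A1 A2 : F A1 <= height s c a -> F A2 + (A1 == A2) <= height s c b ->
    forall x, height s3 (c3 A1 A2) x <= height s c x.
  move=> le1 le2 x; have [->|xa] := eqVneq x a; first by rewrite h3a.
  by have [->|xb] := eqVneq x b; rewrite ?h3b // h3E.
have capE A1 A2 k :
    cap (class_size (c3 A1 A2)) k = cap F k + (F A1 < k) + (F A2 + (A1 == A2) < k).
  have s3ba : (s3 a).+1 = s3 b by rewrite s3a s3b.
  have s3bn : (s3 b).+1 = n by rewrite s3b.
  rewrite (cap_last_two (c3 A1 A2) k s3ba s3bn) h3a h3b s3a.
  by rewrite (eq_cap (fun j => fE A1 A2 (s b) j (leqnn _))).
have cE k : cap (class_size c) k = cap F k + (F (c b) < k) + (F (c a) + (c b == c a) < k).
  by rewrite (cap_last_two c k sab san) ha.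
have [cab|cab] := eqVneq (c b) (c a); last first.
  exists (c3 (c a) (c b)); split=> [k|]; last first.
    by apply: le; rewrite ?ha ?hb ?leq_addr // eq_sym (negbTE cab) addn0.
  by rewrite capE eq_sym (negbTE cab) addn0 addnAC; have := dom k; rewrite cE (negbTE cab) addn0.
rewrite -cab eqxx in cE ha; set A := c b in cE ha hb cab; pose i := F A.
(* If another column has height i + 1, moving a there gives the same shape. *)
have [/existsP[A2 /andP[A2A /eqP FA2]]|no] := boolP [exists j, (j != A) && (F j == i.+1)].
  exists (c3 A2 A); split=> [k|].
    by rewrite capE (negbTE A2A) addn0 FA2; have := dom k; rewrite cE /i; lia.
  by apply: le; rewrite ?(negbTE A2A) ?addn0 ?hb // ha FA2 addn1.
have /existsP[A0 /andP[A0A FA0]] : [exists j, (j != A) && (F j <= i)].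
  apply: contraT => /existsPn no0.
  have : \sum_(j | j != A) 1 <= \sum_j F j.
    rewrite [leqRHS](bigID (fun j => j != A)) /=; apply: leq_trans (leq_addr _ _).
    by apply: leq_sum => j jA; have := no0 j; rewrite jA /= -ltnNge; apply: leq_ltn_trans.
  rewrite sum_filled; last exact: ltnW.
  by rewrite sum1_card (_ : #|_| = n.-1) ?cardC1 ?card_ord //; lia.
case: (@arg_maxnP _ A0 (fun j => (j != A) && (F j <= i)) F); first by rewrite A0A.
move=> A1 /andP[A1A FA1] A1max.
exists (c3 A A1); split=> [k|]; last first.
  by apply: le; rewrite 1?eq_sym ?(negbTE A1A) ?addn0 ?hb // ha leq_addr.
rewrite capE eq_sym (negbTE A1A) addn0; have := dom k; rewrite cE -/i.
case: (leqP k (F A1)) => kh; first by lia.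
case: (ltnP i.+1 k) => ki; first by lia.
suff : cap (class_size c) k < cap beta k by rewrite cE -/i; lia.
rewrite ltn_neqAle dom andbT; apply/eqP => eqk.
case: k kh ki eqk => [//|k] kh ki eqk.
have szE j : class_size c j = F j + (A == j) * 2.
  by rewrite -(filled_last c j san) filledS -cab -sab filledS -/A -/(F j) muln2 -addnn addnA.
have no_k j : class_size c j != k.+1.
  rewrite szE; have [<-|jA] := eqVneq A j; first by rewrite -/i; lia.
  rewrite addn0; apply/eqP => Fj; move/existsPn/(_ j): no; rewrite eq_sym jA Fj /=.
  have := A1max j; rewrite eq_sym jA /= Fj; lia.
have := cap_count_zero no_k; have := dom k; have := dom k.+2 => d2 d0 lin.
have nobeta j : beta j <= k.
  rewrite leqNgt; apply/negP => kj.
  have [|j' j'k] := nogap k.+1 isT; first by exists j.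
  by have := cap_count_pos j'k; lia.
have topmost : cap beta k.+1 = cap beta k.+2.
  by rewrite !cap_ge_heights // => j; apply: leq_trans (nobeta j) _; lia.
have : cap (class_size c) k.+1 < cap (class_size c) k.+2.
  by apply: (cap_lt_next (j := A)); rewrite szE eqxx -/i; lia.
by lia.
Qed.

End NoGap.

Local Open Scope ring_scope.

(** * Vandermonde products of a coloring *)

Section Lagrange.
Variables (I : finType) (F : fieldType) (A : {pred I}) (z : I -> F).
Hypothesis z_inj : {in A &, injective z}.

(** Compare the coefficients of degree #|A| - 1 in h and in its Lagrange
    interpolation at the points z i. *)
Lemma lagrange_lead_coef (h : {poly F}) : h \is monic -> size h = #|A| ->
  \sum_(i in A) h.[z i] / \prod_(j in A | j != i) (z i - z j) = 1.
Proof.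
move=> h_monic size_h.
pose den i := \prod_(j in A | j != i) (z i - z j).
pose num i : {poly F} := \prod_(j in A | j != i) ('X - (z j)%:P).
pose L := \sum_(i in A) (h.[z i] / den i) *: num i.
have size_num i : i \in A -> size (num i) = #|A|.
  move=> Ai; rewrite /num -big_filter size_prod_XsubC size_filter (cardD1 i) Ai add1n.
  congr _.+1; rewrite -sum1_count -sum1_card; apply: eq_bigl => j.
  by rewrite !inE andbC.
have num_monic i : num i \is monic.
  by rewrite monic_prod_XsubC.
have den0 i : i \in A -> den i != 0.
  move=> Ai; apply/prodf_neq0 => j /andP[Aj ji].
  by rewrite subr_eq0; apply: contraNneq ji => /z_inj ->.
have numE i k : k \in A -> i != k -> (num i).[z k] = 0.
  move=> Ak ik; rewrite /num (bigD1 k) /=; last by rewrite Ak eq_sym.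
  by rewrite hornerM hornerXsubC subrr mul0r.
have numii i : (num i).[z i] = den i.
  by rewrite horner_prod; apply: eq_bigr => j _; rewrite hornerXsubC.
have LE k : k \in A -> L.[z k] = h.[z k].
  move=> Ak; rewrite horner_sum (bigD1 k) //= big1 ?addr0 => [|i /andP[Ai ik]].
    by rewrite hornerZ numii divfK ?den0.
  by rewrite hornerZ numE ?mulr0.
have size_L : (size L <= #|A|)%N.
  apply: leq_trans (size_sum _ _ _) _; apply/bigmax_leqP => i Ai.
  by apply: leq_trans (size_scale_leq _ _) _; rewrite size_num.
have hL : h = L.
  apply/eqP; rewrite -subr_eq0; apply/eqP/(roots_geq_poly_eq0 (rs := map z (enum A))).
  - apply/allP => y /mapP[i]; rewrite mem_enum => Ai ->.
    by rewrite rootE hornerD hornerN LE ?subrr.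
  - by rewrite map_inj_in_uniq ?enum_uniq // => i j; rewrite !mem_enum; apply: z_inj.
  - rewrite size_map -cardE; apply: leq_trans (size_polyD _ _) _.
    by rewrite size_polyN geq_max size_h leqnn.
have : h`_(#|A|).-1 = 1 by rewrite -size_h; apply/eqP.
rewrite {1}hL coef_sum; apply: etrans; apply: eq_bigr => i Ai.
by rewrite coefZ -(size_num _ Ai) -/(lead_coef _) (monicP (num_monic i)) mulr1.
Qed.

End Lagrange.

Section ColoringPolynomials.
Variables (n : nat) (K : fieldType).
Implicit Types (c : 'I_n -> 'I_n) (o : rel 'I_n).
Local Notation P := (mpoly n K).
Local Notation var i := (mpolyX K (mnm1 (i : 'I_n))).

(** The product of the differences inside the color classes, where the relation
    o chooses the sign of each difference. *)
Definition oprod o c : P :=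
  \prod_x \prod_(y | (c y == c x) && o y x) (var x - var y).

Definition orients c o := forall x y, c x = c y -> o x y = (x != y) && ~~ o y x.

Lemma oprod_sign o o' c : orients c o -> orients c o' ->
  oprod o c = oprod o' c \/ oprod o c = - oprod o' c.
Proof.
move=> oo oo'.
have normal o1 : orients c o1 -> oprod o1 c =
    \prod_(p : 'I_n * 'I_n | (c p.2 == c p.1) && (p.2 < p.1)%N)
      (if o1 p.2 p.1 then var p.1 - var p.2 else var p.2 - var p.1).
  move=> or1; rewrite /oprod pair_big_dep /=.
  rewrite (bigID (fun p : 'I_n * 'I_n => (p.2 < p.1)%N)) /=.
  rewrite [X in _ * X](reindex_inj (h := fun p => (p.2, p.1))) /=; last first.
    by move=> [? ?] [? ?] [-> ->].
  rewrite [RHS](bigID (fun p : 'I_n * 'I_n => o1 p.2 p.1)) /=.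
  congr (_ * _); apply: eq_big => -[x y] /=.
  - by rewrite andbAC.
  - by case/andP=> /andP[_ ->].
  - rewrite -leqNgt [in RHS]eq_sym; case: eqP => //= cxy.
    by rewrite or1 // ltn_neqAle (inj_eq val_inj) [y == x]eq_sym andbAC.
  - move=> /andP[/andP[/eqP cxy]]; rewrite or1 // => /andP[_ /negbTE->].
    by [].
rewrite !normal //.
apply: (big_ind2 (fun a b : P => a = b \/ a = - b)); first by left.
  move=> a b a' b' [->|->] [->|->]; rewrite ?mulNr ?mulrN ?opprK; by [left|right].
move=> p _; do 2![case: ifP => _]; rewrite ?opprB; by [left|right].
Qed.

Definition vdm c : P := oprod (fun x y => (x < y)%N) c.

Lemma orients_ltn c : orients c (fun x y => (x < y)%N).
Proof. by move=> x y _; rewrite -leqNgt ltn_neqAle (inj_eq val_inj). Qed.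

Definition recolor c i q := fun x : 'I_n => if x == i then q else c x.

(** The orientation that isolates the factors in which i occurs. *)
Definition topmost i : rel 'I_n := fun y x => (y != i) && ((x == i) || (y < x)%N).

Lemma orients_topmost c i : orients c (topmost i).
Proof.
move=> x y _; rewrite /topmost; have [->|xi] := eqVneq x i.
  by rewrite /= andbT eq_sym; case: eqVneq.
have [->|yi] /= := eqVneq y i; first by rewrite xi.
by rewrite /= -leqNgt ltn_neqAle (inj_eq val_inj).
Qed.

Lemma oprod_topmost c i : oprod (topmost i) c =
  \prod_(y | (c y == c i) && (y != i)) (var i - var y) *
  \prod_(x | x != i) \prod_(y | [&& c y == c x, y != i & (y < x)%N]) (var x - var y).
Proof.
rewrite /oprod (bigD1 i) //=; congr (_ * _).
  by apply: eq_bigl => y; rewrite /topmost eqxx andbT.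
by apply: eq_bigr => x xi; apply: eq_bigl => y; rewrite /topmost (negbTE xi).
Qed.

(** Moving i to the color q only changes the factors in which i occurs. *)
Lemma oprod_recolor c i q : c i != q ->
  oprod (topmost i) (recolor c i q) * \prod_(y | (c y == c i) && (y != i)) (var i - var y) =
  oprod (topmost i) c * \prod_(y | c y == q) (var i - var y).
Proof.
move=> ciq; rewrite !oprod_topmost.
rewrite -mulrA mulrC [in LHS](mulrC (\prod_(x | x != i) _)); congr (_ * _ * _).
  apply: eq_bigr => x xi; apply: eq_bigl => y; rewrite /recolor (negbTE xi).
  by have [|yi] := eqVneq y i; rewrite ?andbF.
apply: eq_bigl => y; rewrite /recolor eqxx; have [->|] := eqVneq y i; last by rewrite andbT.
by rewrite eqxx (negbTE ciq).
Qed.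

Lemma var_inj : injective (fun i => var i).
Proof.
move=> i j /(congr1 (mcoeff (mnm1 i))); rewrite !mcoeffX eqxx.
have [/eqP|_ /eqP] := eqVneq (mnm1 j) (mnm1 i); first by rewrite eq_mnm1 => /eqP.
by rewrite oner_eq0.
Qed.

Lemma class_sizeE c p : class_size c p = #|[pred x | c x == p]|.
Proof. by rewrite /class_size -sum1_card [RHS]big_mkcond. Qed.

(** Lagrange interpolation at the variables of color p of a monic polynomial
    that vanishes at the variables of color q; this works over every field. *)
Lemma vdm_exchange c p q : (class_size c q < class_size c p)%N ->
  exists a : 'I_n -> P, vdm c = \sum_(i | c i == p) a i * vdm (recolor c i q).
Proof.
move=> qp; have pq : p != q by apply: contraTneq qp => ->; rewrite ltnn.
pose d := ((class_size c p).-1 - class_size c q)%N.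
pose z i := FracField.tofrac (var i).
have z_inj : injective z by move=> i j /eqP; rewrite tofrac_eq => /eqP/var_inj.
(* d brings the degree of h to one less than the number of interpolation points. *)
pose h := 'X^d * \prod_(y | c y == q) ('X - (z y)%:P).
have h_monic : h \is monic by rewrite monicMl ?monicXn ?monic_prod_XsubC.
have size_h : size h = #|[pred x | c x == p]|.
  rewrite -class_sizeE size_monicM ?monicXn ?monic_neq0 ?monic_prod_XsubC //.
  rewrite size_polyXn -big_filter size_prod_XsubC size_filter.
  rewrite -sum1_count big_mkcond /= -/(class_size c q) /d; lia.
have := lagrange_lead_coef (in2W z_inj) h_monic size_h.
move=> /(congr1 (fun u => FracField.tofrac (vdm c) * u)); rewrite mulr1 mulr_sumr => E.
have sg i c1 : exists b : bool, oprod (topmost i) c1 = (-1) ^+ b * vdm c1.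
  have [->|->] := oprod_sign (@orients_topmost c1 i) (@orients_ltn c1).
    by exists false; rewrite mul1r.
  by exists true; rewrite mulN1r.
have {}sg i : exists b : bool, c i = p ->
    vdm c * \prod_(y | c y == q) (var i - var y) =
    (-1) ^+ b * vdm (recolor c i q) * \prod_(y | (c y == c i) && (y != i)) (var i - var y).
  have [b bE] := sg i c; have [b' b'E] := sg i (recolor c i q).
  exists (b (+) b') => cip; have := @oprod_recolor c i q; rewrite cip => /(_ pq).
  rewrite bE b'E => /(congr1 (fun u => (-1) ^+ b * u)).
  by rewrite signr_addb !mulrA -!signr_addb addbb mul1r => <-.
have [b bE] := fin_all_exists sg.
exists (fun i => (-1) ^+ b i * var i ^+ d); apply/eqP; rewrite -tofrac_eq; apply/eqP.
rewrite -{}E rmorph_sum; apply: eq_bigr => i /eqP cip.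
have den0 : \prod_(j in [pred x | c x == p] | j != i) (z i - z j) != 0.
  by apply/prodf_neq0 => j /andP[_ ji]; rewrite subr_eq0 (inj_eq z_inj) eq_sym.
rewrite mulrA; apply: (mulIf den0); rewrite divfK // /h hornerM hornerXn horner_prod.
have := bE i cip; move: (vdm c) (vdm (recolor c i q)) => V0 V.
move/(congr1 (fun u => z i ^+ d * FracField.tofrac u)).
rewrite !rmorphM /= !rmorph_prod cip.
have -> : \prod_(y | c y == q) FracField.tofrac (var i - var y) =
    \prod_(y | c y == q) ('X - (z y)%:P).[z i].
  by apply: eq_bigr => y _; rewrite rmorphB hornerXsubC.
have -> : \prod_(y | (c y == p) && (y != i)) FracField.tofrac (var i - var y) =
    \prod_(j in [pred x | c x == p] | j != i) (z i - z j).
  by apply: eq_bigr => y _; rewrite rmorphB.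
rewrite mulrCA => ->; rewrite !mulrA; congr (_ * _ * _).
by rewrite mulrC; congr (_ * _); rewrite rmorphXn.
Qed.

Lemma class_size_recolor c i q j :
  (class_size (recolor c i q) j + (c i == j) = class_size c j + (q == j))%N.
Proof.
rewrite /class_size (bigD1 i) //= [in RHS](bigD1 i) //= /recolor eqxx addnAC.
rewrite [RHS]addnAC [in RHS](addnC (_ == _)); congr (_ + _ + _)%N.
by apply: eq_bigr => x /negbTE->.
Qed.

End ColoringPolynomials.

Section Straightening.
Variables (n : nat) (K : fieldType) (I : mpoly n K -> Prop) (beta : 'I_n -> nat).
Hypotheses (I0 : I 0) (ID : forall f g, I f -> I g -> I (f + g)).
Hypothesis IM : forall a f, I f -> I (a * f).
Hypothesis sum_beta : (\sum_j beta j = n)%N.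
Hypothesis I_beta : forall c, cap (class_size c) =1 cap beta -> I (vdm K c).

Lemma sum_class_size (c : 'I_n -> 'I_n) : (\sum_j class_size c j = n)%N.
Proof. by under eq_bigr do rewrite -(filled_full 1%g); rewrite sum_filled. Qed.

Lemma cap_total (h : 'I_n -> nat) k : (\sum_j h j = n)%N -> (n <= k)%N -> cap h k = n.
Proof.
move=> hn nk; rewrite cap_ge_heights // => j; apply: leq_trans nk; rewrite -[leqRHS]hn.
by rewrite (bigD1 j) //= leq_addr.
Qed.

(** As long as the shape of c differs from beta, some box can be moved from a
    column to a column lower by at least two, without leaving the shapes
    dominated by beta; the exchange relation expresses vdm c by the results. *)
Lemma dominated_vdm c : dominated (class_size c) beta -> I (vdm K c).
Proof.
have [N] := ubnP (\sum_(k < n.+1) (cap beta k - cap (class_size c) k))%N.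
elim: N c => [//|N IH] c; rewrite ltnS => leN domc.
have [eqc|] := boolP [forall k : 'I_n.+1, cap (class_size c) k == cap beta k].
  apply: I_beta => k; case: (ltnP k n.+1) => kn.
    exact/eqP/(forallP eqc (Ordinal kn)).
  by rewrite !cap_total ?sum_class_size //; apply: ltnW.
rewrite negb_forall => /existsP[[k0 /= k0n] nek0].
pose sz := class_size c.
have lt0 : (cap sz k0 < cap beta k0)%N by rewrite ltn_neqAle nek0 domc.
(* l < k0 < u bound a maximal interval where the inequality is strict; there the
   second differences show that l and u are column heights. *)
have [l [l0 lk lmax]] : exists l, [/\ cap sz l = cap beta l, (l < k0)%N &
    forall k, (l < k <= k0)%N -> (cap sz k < cap beta k)%N].
  have ex0 : exists l, (l < k0)%N && (cap sz l == cap beta l).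
    by exists 0%N; rewrite !cap0 eqxx andbT; case: (k0) lt0; rewrite ?cap0.
  have bd l : (l < k0)%N && (cap sz l == cap beta l) -> (l <= k0)%N.
    by case/andP => /ltnW.
  case: (ex_maxnP ex0 bd) => l /andP[lk /eqP l0] lmax; exists l; split=> // k /andP[lk1].
  rewrite leq_eqVlt => /orP[/eqP-> //|kk0]; rewrite ltn_neqAle domc andbT.
  by apply: contraL lk1 => k00; rewrite -leqNgt; apply: lmax; rewrite kk0.
have [u [u0 ku umin]] : exists u, [/\ cap sz u = cap beta u, (k0 < u)%N &
    forall k, (k0 <= k < u)%N -> (cap sz k < cap beta k)%N].
  have ex0 : exists u, (k0 < u)%N && (cap sz u == cap beta u).
    by exists n.+1; rewrite k0n !cap_total ?sum_class_size ?eqxx.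
  case: (ex_minnP ex0) => u /andP[ku /eqP u0] umin; exists u; split=> // k /andP[].
  rewrite leq_eqVlt => /orP[/eqP<- //|kk0 ku1]; rewrite ltn_neqAle domc andbT.
  by apply: contraL ku1 => k00; rewrite -leqNgt; apply: umin; rewrite kk0.
have slack k : (l < k < u)%N -> (cap sz k < cap beta k)%N.
  by move=> /andP[lk1 ku1]; case: (leqP k k0) => kk0; [apply: lmax | apply: umin]; lia.
have /existsP[q /eqP qE] : [exists q, sz q == l].
  apply: contraT; rewrite negb_exists => /forallP no.
  have := slack l.+1 ltac:(lia); case: l l0 no {lk lmax slack} => [_ no|l l0 no].
    rewrite ltnNge; case/negP; apply: (@leq_trans n).
      rewrite -[leqRHS]card_ord -sum1_card; apply: leq_sum => j _; exact: geq_minr.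
    rewrite -[leqLHS]card_ord -sum1_card; apply: leq_sum => j _.
    by rewrite leq_min andbT lt0n no.
  by have := cap_count_zero no; have := cap_concave beta l; have := domc l; rewrite -/sz; lia.
have /existsP[p /eqP pE] : [exists p, sz p == u].
  apply: contraT; rewrite negb_exists => /forallP no.
  have := slack u.-1 ltac:(lia); case: u u0 no ku {umin slack} => [//|u] u0 no _ /=.
  have := cap_count_zero no; have := cap_concave beta u; have := domc u.+2; rewrite -/sz; lia.
have [|a ->] := @vdm_exchange n K c p q; first by rewrite -/sz pE qE; lia.
apply: (big_ind I) => // i /eqP cip; apply: IM.
have capE k : (cap (class_size (recolor c i q)) k + (u.-1 < k) = cap sz k + (l < k))%N.
  have rE := class_size_recolor c i q; pose g j := (sz j + (q == j))%N.
  rewrite -qE -(@cap_incr _ _ g q) // (@cap_incr _ (class_size (recolor c i q)) g p) => [|j].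
    congr (_ + (_ < k))%N; have := rE p; rewrite -/sz pE cip eqxx.
    have -> : q == p = false by apply/eqP => qp; move: pE; rewrite -qp; lia.
    by lia.
  by rewrite /g -rE cip.
apply: IH => [|k]; last first.
  have := capE k; have := domc k; rewrite -/sz.
  case: (ltnP l k) => lk1; last by lia.
  case: (ltnP k u) => ku1; last by lia.
  by have := slack k ltac:(lia); lia.
apply: leq_trans leN; rewrite (bigD1 (Ordinal k0n)) //= [ltnRHS](bigD1 (Ordinal k0n)) //=.
rewrite -addSn; apply: leq_add.
  by have := capE k0; rewrite -/sz; lia.
apply: leq_sum => k _; have := capE k; have := domc k; rewrite -/sz.
case: (ltnP l k) => lk1; last by lia.
by case: (ltnP k u) => ku1; lia.
Qed.

End Straightening.

(** * Nonvanishing at points with few distinct coordinates *)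

Lemma seq_arg_max (T : eqType) (F : T -> nat) (r : seq T) (e : T) : e \in r ->
  exists2 e', e' \in r & forall m, m \in r -> (F m <= F e')%N.
Proof.
elim: r e => [//|m1 r1 IHr] e _.
have [->|] := eqVneq r1 [::].
  by exists m1; rewrite ?mem_head // => m; rewrite inE => /eqP->.
case: r1 IHr => [//|m2 r2] IHr _; have [e' e'r e'max] := IHr m2 (mem_head _ _).
case: (leqP (F m1) (F e')) => le1.
  by exists e'; [rewrite inE e'r orbT | move=> m; rewrite inE => /orP[/eqP->|/e'max]].
exists m1; rewrite ?mem_head // => m; rewrite inE => /orP[/eqP-> //|/e'max le2].
exact: leq_trans le2 (ltnW le1).
Qed.

Section NonVanishing.
Variables (n : nat) (K : fieldType) (D : idomainType) (phi : {rmorphism K -> D}).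
Implicit Types (s : {perm 'I_n}) (f : mpoly n K) (e m : multinom n).

(** e is the largest exponent of f for the lexicographic order in which the
    variable of largest rank is compared first. *)
Definition lex_max s f e := e \in msupp f /\
  forall m, m \in msupp f -> forall x, (forall y, (s x < s y)%N -> m y = e y) ->
    (m x <= e x)%N.

Lemma lex_max_exists s f : f != 0 -> exists e, lex_max s f e.
Proof.
move=> f0; suff /(_ n (leqnn n)) [e [ef eP]] : forall i, (i <= n)%N ->
    exists e, e \in msupp f /\ forall m, m \in msupp f -> forall x,
     (n - i <= s x)%N -> (forall y, (s x < s y)%N -> m y = e y) -> (m x <= e x)%N.
  by exists e; split=> // m mf x; apply: eP => //; rewrite subnn.
elim=> [_|i IH lin].
  have : msupp f != [::] by rewrite msupp_eq0.
  case E : (msupp f) => [//|e r] _; exists e; rewrite mem_head; split=> // m _ x.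
  by rewrite subn0 leqNgt ltn_ord.
have {IH} [e [ef eP]] := IH (ltnW lin).
have ltn' : (n - i.+1 < n)%N by lia.
pose x0 := (s^-1)%g (Ordinal ltn').
have sx0 : s x0 = (n - i.+1)%N :> nat by rewrite permKV.
pose P (m : multinom n) := [forall y, (s x0 < s y)%N ==> (m y == e y)].
pose r := [seq m <- msupp f | P m].
have er : e \in r.
  by rewrite mem_filter ef andbT; apply/forallP => y; rewrite eqxx implybT.
have [e' e'r e'max] := seq_arg_max (fun m : multinom n => m x0) er.
move: e'r; rewrite mem_filter => /andP[/forallP e'e e'f].
exists e'; split=> // m mf x; rewrite leq_eqVlt => /orP[/eqP sx|sx] mE.
  have -> : x = x0 by apply: (@perm_inj _ s); apply: val_inj; rewrite /= sx0 -sx.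
  apply: e'max; rewrite mem_filter mf andbT; apply/forallP => y; apply/implyP => ys.
  have xy : (s x < s y)%N by rewrite -sx -sx0.
  by rewrite mE // eq_sym (eqP (implyP (e'e y) _)).
have e'E y : (s x < s y)%N -> e' y = e y.
  by move=> xy; apply/eqP; rewrite (implyP (e'e y)) // sx0; lia.
have -> : e' x = e x by apply/eqP; rewrite (implyP (e'e x)) // sx0; lia.
by apply: (eP _ mf) => [|y xy]; rewrite -?e'E ?mE //; lia.
Qed.

(** The coordinates are chosen one by one by increasing rank. The terms of f that
    agree with e on the later variables form a polynomial of degree e x in the
    next coordinate, so one of any e x + 1 values is not a root. Taking the
    e x + 1 values used most often so far makes the multiplicities grow at least
    as fast as the rows of the greedy filling. *)
Lemma nonvanishing s f e c (v0 : nat -> D) : injective v0 ->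
  lex_max s f e -> greedy s e c ->
  exists (a : 'I_n -> D) (v : nat -> D), [/\ injective v, mmap phi a f != 0 &
    forall k, (cap (class_size c) k <= \sum_(l < k) \sum_x (a x == v l))%N].
Proof.
move=> v0_inj [ef emax] gr.
pose agree i m := [forall x, (i <= s x)%N ==> (m x == e x)].
(* The terms that agree with e on the variables of rank at least i, with the
   other variables evaluated. *)
pose part i (a : 'I_n -> D) : D := \sum_(m <- msupp f | agree i m)
  phi (mcoeff m f) * \prod_(x | (s x < i)%N) a x ^+ m x.
pose mult i (a : 'I_n -> D) (v : nat -> D) l := (\sum_(x | (s x < i)%N) (a x == v l))%N.
suff /(_ n (leqnn n)) [a [v [vi an0 _ capS]]] : forall i, (i <= n)%N ->
    exists a v, [/\ injective v, part i a != 0,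
      forall l, (mult i a v l.+1 <= mult i a v l)%N &
      forall k, (cap (filled s c i) k <= \sum_(l < k) mult i a v l)%N].
  exists a, v; split=> //.
    suff -> : mmap phi a f = part n a by [].
    rewrite /mmap /part [RHS]big_mkcond; apply: eq_bigr => m _.
    have -> : agree n m by apply/forallP => x; rewrite leqNgt ltn_ord.
    by congr (_ * _); apply: eq_bigl => x; rewrite ltn_ord.
  move=> k; rewrite -(eq_cap (filled_full s c)).
  apply: leq_trans (capS k) _; apply: leq_sum => l _.
  by rewrite /mult; under eq_bigl do rewrite ltn_ord.
apply: (stage_ind (s := s)) => [|x [a [v [vi an0 mono capS]]]].
  exists (fun=> 0), v0; split=> //.
  - have ee : agree 0 e by apply/forallP => y; rewrite eqxx implybT.
    rewrite /part big_mkcond (bigD1_seq e) ?msupp_uniq //= ee.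
    rewrite big_pred0 ?mulr1 // big1 ?addr0 => [|m me].
      by rewrite fmorph_eq0 -mcoeff_msupp.
    case: ifP => // /forallP mE; case/eqP: me.
    by apply/mnmP => y; apply/eqP/mE.
  - by move=> l; rewrite /mult !big_pred0.
  - by move=> k; rewrite (eq_cap (filled0 s c)) {1}/cap big1 // => j _; rewrite min0n.
(* the partial evaluation as a polynomial in the value given to x *)
pose coefx m : D := phi (mcoeff m f) * \prod_(y | (s y < s x)%N) a y ^+ m y.
pose q : {poly D} := \sum_(m <- msupp f | agree (s x).+1 m) coefx m *: 'X^(m x).
have le_e m : m \in msupp f -> agree (s x).+1 m -> (m x <= e x)%N.
  move=> mf /forallP mE; apply: emax => // y xy.
  by apply/eqP; move: (mE y); rewrite xy.
have agreeS m : agree (s x) m = agree (s x).+1 m && (m x == e x).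
  apply/forallP/andP => [mE|[/forallP mE mx] y].
    split; last by have := mE x; rewrite leqnn.
    by apply/forallP => y; apply/implyP => xy; apply: (implyP (mE y)); apply: ltnW.
  rewrite leq_eqVlt; case: eqP => /= [/val_inj/perm_inj <- //|_]; exact: mE.
have q_coef : q`_(e x) = part (s x) a.
  rewrite coef_sum /part (eq_bigl _ _ agreeS) big_mkcondr /=.
  by apply: eq_bigr => m _; rewrite coefZ coefXn eq_sym; case: eqP; rewrite (mulr1, mulr0).
have q0 : q != 0 by apply: contraNneq an0 => q0; rewrite -q_coef q0 coef0.
have size_q : (size q <= (e x).+1)%N.
  rewrite /q big_seq_cond; apply: (leq_trans (size_sum _ _ _)).
  apply/bigmax_leqP_seq => m _ /andP[mf mE].
  by apply: leq_trans (size_scale_leq _ _) _; rewrite size_polyXn ltnS le_e.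
have [l le_l vl] : exists2 l, (l <= e x)%N & q.[v l] != 0.
  have /allPn[y /mapP[l]] : ~~ all (root q) [seq v l | l <- iota 0 (e x).+1].
    apply: contraL size_q => /(max_poly_roots q0).
    by rewrite map_inj_uniq // iota_uniq size_map size_iota -ltnNge; apply.
  by rewrite mem_iota add0n ltnS => /= lx -> vl; exists l.
pose a' y := if y == x then v l else a y.
have evq : part (s x).+1 a' = q.[v l].
  rewrite /q horner_sum; apply: eq_bigr => m _; rewrite hornerZ hornerXn /coefx.
  rewrite -mulrA; congr (_ * _); rewrite (bigD1 x) //= mulrC.
  rewrite /a' eqxx; congr (_ * _); apply: eq_big => [y|y /andP[_ /negbTE->]//].
  by rewrite andbC ltnS [RHS]ltn_neqAle (inj_eq val_inj) (inj_eq perm_inj).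
(* relabel so that the multiplicities stay sorted *)
pose M := mult (s x) a v.
have mono_le i j : (i <= j)%N -> (M j <= M i)%N.
  by move/subnK <-; elim: (j - i)%N => [//|d IH]; apply: leq_trans (mono _) IH.
have exl : exists r, M r == M l by exists l.
pose l' := ex_minn exl.
have [Ml' l'min] : M l' = M l /\ forall r, M r = M l -> (l' <= r)%N.
  by rewrite /l'; case: ex_minnP => r /eqP -> rmin; split=> // r' /eqP/rmin.
have l'l : (l' <= l)%N by apply: l'min.
pose sw r := if r == l then l' else if r == l' then l else r.
have swK : involutive sw by move=> r; rewrite /sw; do !case: eqP => //=; congruence.
pose v' r := v (sw r).
have multE r : mult (s x).+1 a' v' r = (M r + (l' == r))%N.
  rewrite /mult (bigD1 x) ?leqnn //= addnC {2}/a' eqxx; congr (_ + _)%N; last first.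
    rewrite /v' (inj_eq vi) /sw; do !case: eqP => //=; congruence.
  transitivity (mult (s x) a v' r); last first.
    by rewrite -[mult _ _ _ _]/(M (sw r)) /sw; case: eqP => [->|_] //; case: eqP => [->|].
  rewrite /mult; apply: eq_big => [y|y /andP[_ /negbTE]]; last by rewrite /a' => ->.
  by rewrite andbC ltnS [RHS]ltn_neqAle (inj_eq val_inj) (inj_eq perm_inj).
have mono' r : (mult (s x).+1 a' v' r.+1 <= mult (s x).+1 a' v' r)%N.
  rewrite !multE; have := mono r; rewrite -/(M r.+1) -/(M r).
  case: (l' =P r.+1) => [l'r|_]; last by lia.
  suff : M r != M r.+1 by lia.
  by apply/eqP => Mr; have := l'min r; rewrite Mr -l'r Ml' => /(_ erefl); lia.
have sumE k : (\sum_(r < k) mult (s x).+1 a' v' r = \sum_(r < k) M r + (l' < k))%N.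
  under eq_bigr do rewrite multE.
  rewrite big_split /=; congr (_ + _)%N.
  case: (ltnP l' k) => lk; last first.
    by rewrite big1 // => r _; have := ltn_ord r; lia.
  rewrite (bigD1 (Ordinal lk)) //= eqxx big1 // => r.
  by rewrite -(inj_eq val_inj) /= eq_sym => /negbTE->.
exists a', v'; split.
- by move=> r1 r2 /vi /(can_inj swK).
- by rewrite evq.
- exact: mono'.
move=> k; rewrite sumE; pose S k' := (\sum_(r < k') M r)%N.
apply: (greedy_step (S := S) (gr x)) => //; first exact: leq_trans l'l le_l.
move=> k'; rewrite -!sumE !big_ord_recr /=; have := mono' k'; lia.
Qed.

End NonVanishing.

(** * Supports, weights and components *)

Section Supports.
Variables (K : fieldType) (n : nat).
Implicit Types (f g : mpoly n K) (m e : multinom n) (Q : multinom n -> Prop).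
Local Notation mon m := (mpolyX K m).

Definition supported Q f := forall m, m \in msupp f -> Q m.

Lemma supported_sub Q Q' f : (forall m, Q m -> Q' m) -> supported Q f -> supported Q' f.
Proof. by move=> QQ' fQ m /fQ/QQ'. Qed.

Lemma supported0 Q : supported Q 0.
Proof. by move=> m; rewrite msupp0. Qed.

Lemma supportedD Q f g : supported Q f -> supported Q g -> supported Q (f + g).
Proof. by move=> fQ gQ m /msuppD_le; rewrite mem_cat => /orP[/fQ|/gQ]. Qed.

Lemma supportedZ Q a f : supported Q f -> supported Q (a *: f).
Proof. by move=> fQ m /msuppZ_le /fQ. Qed.

Lemma supportedN Q f : supported Q f -> supported Q (- f).
Proof. by rewrite -scaleN1r; apply: supportedZ. Qed.

Lemma supportedB Q f g : supported Q f -> supported Q g -> supported Q (f - g).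
Proof. by move=> fQ gQ; apply: supportedD => //; apply: supportedN. Qed.

Lemma supportedX Q m : Q m -> supported Q (mon m).
Proof. by move=> Qm m'; rewrite msuppX inE => /eqP->. Qed.

Lemma supportedM Q Q' Q'' f g :
  (forall m m', Q m -> Q' m' -> Q'' (mnm_add m m')) ->
  supported Q f -> supported Q' g -> supported Q'' (f * g).
Proof.
move=> QQ fQ gQ m /msuppM_le /allpairsP[[m1 m2] /= [m1f m2g ->]].
by apply: QQ; [apply: fQ | apply: gQ].
Qed.

Lemma mpoly_monomial_ind (V : mpoly n K -> Prop) f :
  V 0 -> (forall g h, V g -> V h -> V (g + h)) -> (forall a g, V g -> V (a *: g)) ->
  supported (fun m => V (mon m)) f -> V f.
Proof.
move=> V0 VD VZ fV; rewrite (mpolyE f) big_seq.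
by apply: (big_ind V) => // m mf; apply/VZ/fV.
Qed.

End Supports.

Section Weights.
Variables (R : realType) (K : fieldType) (n : nat).
Implicit Types (f g : mpoly n K) (m e : multinom n) (w u : 'rV[R]_n) (W : R).
Local Notation mon m := (mpolyX K m).
Local Notation var x := (mpolyX K (mnm1 x)).

Lemma weightD w m m' : weight w (mnm_add m m') = weight w m + weight w m'.
Proof.
by rewrite /weight -big_split; apply: eq_bigr => i _ /=; rewrite mnmDE natrD mulrDl.
Qed.

Lemma weight1 w x : weight w (mnm1 x) = w 0 x.
Proof.
rewrite /weight (bigD1 x) //= mnm1E eqxx mul1r big1 ?addr0 // => i ix.
by rewrite mnm1E eq_sym (negbTE ix) mul0r.
Qed.

Lemma weight_lin (a : R) w u m : weight (a *: w + u) m = a * weight w m + weight u m.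
Proof.
rewrite /weight mulr_sumr -big_split; apply: eq_bigr => i _ /=.
by rewrite !mxE mulrDr mulrCA.
Qed.

(** The part of weight W of f; for the largest weight of f this is its initial
    form. *)
Definition component w W f : mpoly n K :=
  \sum_(m <- msupp f | weight w m == W) mcoeff m f *: mon m.

Lemma mcoeff_component w W f m :
  mcoeff m (component w W f) = if weight w m == W then mcoeff m f else 0.
Proof.
rewrite /component raddf_sum /=; under eq_bigr do rewrite mcoeffZ mcoeffX.
have [mf|mf] := boolP (m \in msupp f); last first.
  rewrite (memN_msupp_eq0 mf) if_same big1_seq // => m' /andP[_ m'f].
  case: eqP => [mm|_]; last by rewrite mulr0.
  by rewrite -mm m'f in mf.
rewrite big_mkcond (bigD1_seq m) ?msupp_uniq //= eqxx mulr1 big1 ?addr0 // => m' /negbTE->.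
by rewrite mulr0 if_same.
Qed.

Lemma component_supp w W f : supported (fun m => weight w m = W) (component w W f).
Proof.
move=> m; rewrite mcoeff_msupp mcoeff_component.
by case: ifP => [/eqP //|_]; rewrite eqxx.
Qed.

Lemma component_sub Q w W f : supported Q f -> supported Q (component w W f).
Proof.
move=> fQ m; rewrite mcoeff_msupp mcoeff_component; case: ifP; rewrite ?eqxx // => _.
by rewrite -mcoeff_msupp => /fQ.
Qed.

Lemma componentD w W f g : component w W (f + g) = component w W f + component w W g.
Proof.
apply/mpolyP => m; rewrite mcoeffD !mcoeff_component mcoeffD.
by case: ifP; rewrite ?addr0.
Qed.

Lemma componentZ w W a f : component w W (a *: f) = a *: component w W f.
Proof.
by apply/mpolyP => m; rewrite mcoeffZ !mcoeff_component mcoeffZ; case: ifP; rewrite ?mulr0.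
Qed.

Lemma componentN w W f : component w W (- f) = - component w W f.
Proof. by rewrite -!scaleN1r componentZ. Qed.

Lemma componentB w W f g : component w W (f - g) = component w W f - component w W g.
Proof. by rewrite componentD componentN. Qed.

Lemma component0 w W : component w W 0 = 0.
Proof. by rewrite /component msupp0 big_nil. Qed.

Lemma component_id w W f : supported (fun m => weight w m = W) f -> component w W f = f.
Proof.
move=> fW; apply/mpolyP => m; rewrite mcoeff_component; case: eqP => // neW.
by apply/esym/eqP; rewrite mcoeff_eq0; apply/negP => /fW.
Qed.

Lemma component_low w W f : supported (fun m => weight w m < W) f -> component w W f = 0.
Proof.
move=> fW; apply/mpolyP => m; rewrite mcoeff_component mcoeff0; case: eqP => // mW.
by apply/eqP; rewrite mcoeff_eq0; apply/negP => /fW; rewrite mW ltxx.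
Qed.

Lemma component_rest w W f : supported (fun m => weight w m <= W) f ->
  supported (fun m => weight w m < W) (f - component w W f).
Proof.
move=> fW m; rewrite mcoeff_msupp mcoeffB mcoeff_component lt_neqAle.
case: ifP => _; first by rewrite subrr eqxx.
by rewrite subr0 -mcoeff_msupp => /fW ->.
Qed.

Lemma componentM w W W' f g :
  supported (fun m => weight w m <= W) f -> supported (fun m => weight w m <= W') g ->
  component w (W + W') (f * g) = component w W f * component w W' g.
Proof.
move=> fW gW; have f1 := component_supp (w := w) (W := W) (f := f).
have g1 := component_supp (w := w) (W := W') (f := g).
have f2 := component_rest fW; have g2 := component_rest gW.
rewrite -[in LHS](subrK (component w W f) f) -[in LHS](subrK (component w W' g) g).
move: f1 g1 f2 g2; move: (component w W f) (component w W' g) (f - _) (g - _) => f1 g1 f2 g2.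
move=> f1W g1W f2W g2W; rewrite mulrDl !mulrDr !componentD.
rewrite [X in _ + (_ + X)]component_id; last first.
  by apply: supportedM f1W g1W => m m' <- <-; rewrite weightD.
rewrite !component_low ?add0r //.
- by apply: supportedM f1W g2W => m m' <- ?; rewrite weightD ltrD2l.
- by apply: supportedM f2W g1W => m m' ? <-; rewrite weightD ltrD2r.
- by apply: supportedM f2W g2W => m m' ? ?; rewrite weightD ltrD.
Qed.

Lemma max_weight w f : f != 0 -> exists e,
  e \in msupp f /\ supported (fun m => weight w m <= weight w e) f.
Proof.
rewrite -msupp_eq0 /supported; elim: (msupp f) => [//|m1 r IH] _.
case: (altP (r =P [::])) => [->|/IH [e [er emax]]].
  by exists m1; rewrite mem_head; split=> // m; rewrite inE => /eqP->.
case: (leP (weight w m1) (weight w e)) => le1.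
  by exists e; rewrite inE er orbT; split=> // m; rewrite inE => /orP[/eqP->|/emax].
exists m1; rewrite mem_head; split=> // m; rewrite inE => /orP[/eqP->//|/emax le2].
exact: le_trans le2 (ltW le1).
Qed.

Lemma initial_formE w f e : e \in msupp f ->
  supported (fun m => weight w m <= weight w e) f ->
  initial_form w f = component w (weight w e) f.
Proof.
move=> ef fe; rewrite /initial_form /component big_seq_cond [RHS]big_seq_cond.
apply: eq_bigl => m; case mf: (m \in msupp f) => //=.
apply/allP/eqP => [me|-> m' /fe//].
by apply/eqP; rewrite eq_le fe // me.
Qed.

Lemma initial_form0 w : initial_form w (0 : mpoly n K) = 0.
Proof. by rewrite /initial_form msupp0 big_nil. Qed.

End Weights.

(** * Ideals and leading terms *)

Section Ideals.
Variable A : comNzRingType.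
Implicit Types (G V : set A).

Definition is_ideal V := [/\ V 0, forall f g, V f -> V g -> V (f + g) &
  forall a f, V f -> V (a * f)].

Lemma ideal_gen_ideal G : is_ideal (ideal_gen G).
Proof.
split=> [|f g [k [a [p [pG ->]]]] [k' [a' [p' [p'G ->]]]]|b f [k [a [p [pG ->]]]]].
- by exists 0%N, (fun=> 0), (fun=> 0); split=> [[]//|]; rewrite big_ord0.
- exists (k + k')%N, (fun i => match fintype.split i with inl j => a j | inr j => a' j end).
  exists (fun i => match fintype.split i with inl j => p j | inr j => p' j end); split.
    by move=> i; case: fintype.split.
  rewrite big_split_ord /=; congr (_ + _); apply: eq_bigr => i _.
    by rewrite -[lshift _ _]/(unsplit (inl _)) unsplitK.
  by rewrite -[rshift _ _]/(unsplit (inr _)) unsplitK.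
- exists k, (fun i => b * a i), p; split=> //.
  by rewrite mulr_sumr; apply: eq_bigr => i _; rewrite mulrA.
Qed.

Lemma ideal_gen_in G g : G g -> ideal_gen G g.
Proof.
by move=> Gg; exists 1%N, (fun=> 1), (fun=> g); split=> //; rewrite big_ord1 mul1r.
Qed.

Lemma ideal_gen_min G V : is_ideal V -> (forall g, G g -> V g) ->
  forall f, ideal_gen G f -> V f.
Proof.
move=> [V0 VD VM] GV f [k [a [p [pG ->]]]].
by apply: (big_ind V) => // i _; apply/VM/GV.
Qed.

Lemma idealN V f : is_ideal V -> V f -> V (- f).
Proof. by move=> [_ _ VM] Vf; rewrite -mulN1r; apply: VM. Qed.

Lemma idealB V f g : is_ideal V -> V f -> V g -> V (f - g).
Proof. by move=> Vi Vf Vg; case: (Vi) => _ VD _; apply: VD => //; apply: idealN. Qed.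

End Ideals.

Section LeadingTerms.
Variables (R : realType) (K : fieldType) (n : nat).
Implicit Types (f g : mpoly n K) (m e : multinom n) (w u : 'rV[R]_n) (W : R).
Implicit Types (s : {perm 'I_n}) (c : 'I_n -> 'I_n).
Local Notation mon m := (mpolyX K m).
Local Notation var x := (mpolyX K (mnm1 x)).

Lemma idealZ (V : set (mpoly n K)) a f : is_ideal V -> V f -> V (a *: f).
Proof. by move=> [_ _ VM] Vf; rewrite -mul_mpolyC; apply: VM. Qed.

Section Leads.
Variables C0 C1 : 'rV[R]_n -> Prop.

(** Leading terms are stated for a family of weights at once: those in C0 have
    to be weakly maximal at the leading monomial, those in C1 strictly. *)
Definition below e m := (forall w, C0 w -> weight w m <= weight w e) /\
  (forall w, C1 w -> weight w m < weight w e).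
Definition leads f e := supported (below e) (f - mon e).

(** A product of leading terms has weight above that of all other products, as
    weights are additive. *)
Lemma leadsM f e f' e' : leads f e -> leads f' e' -> leads (f * f') (mnm_add e e').
Proof.
move=> re re'; rewrite /leads mpolyXD.
have -> : f * f' - mon e * mon e' = (f - mon e) * (f' - mon e') +
  (f - mon e) * mon e' + mon e * (f' - mon e') by ring.
have eQ e1 : supported (fun m => m = e1) (mon e1) by apply: supportedX.
apply: supportedD; [apply: supportedD|].
- apply: supportedM re re' => m m' [m0 m1] [m0' m1'].
  split=> w wC; rewrite !weightD; first by apply: lerD; [apply: m0 | apply: m0'].
  by apply: ltrD; [apply: m1 | apply: m1'].
- apply: supportedM re (eQ e') => m _ [m0 m1] ->; split=> w wC; rewrite !weightD.
    by rewrite lerD2r m0.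
  by rewrite ltrD2r m1.
- apply: supportedM (eQ e) re' => _ m' -> [m0 m1]; split=> w wC; rewrite !weightD.
    by rewrite lerD2l m0.
  by rewrite ltrD2l m1.
Qed.

Lemma leads1 : leads 1 (@mnm0 n).
Proof. by rewrite /leads mpolyX0 subrr; apply: supported0. Qed.

Lemma leadsX e : leads (mon e) e.
Proof. by rewrite /leads subrr; apply: supported0. Qed.

Definition lead_exp s c : multinom n := Multinom [tuple height s c x | x < n].

Lemma lead_expE s c x : lead_exp s c x = height s c x.
Proof. exact: mnmE. Qed.

(** Each variable x is the leading term of its differences with the lower
    variables of its column, and their number is the height of x. *)
Lemma leads_prod s c (F : 'I_n -> 'I_n -> mpoly n K) :
  (forall x y, c y = c x -> (s y < s x)%N -> leads (F x y) (mnm1 x)) ->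
  leads (\prod_x \prod_(y | (c y == c x) && (s y < s x)%N) F x y) (lead_exp s c).
Proof.
move=> Flead.
have -> : lead_exp s c = \big[@mnm_add n/@mnm0 n]_x
    \big[@mnm_add n/@mnm0 n]_(y | (c y == c x) && (s y < s x)%N) mnm1 x.
  apply/mnmP => z; rewrite lead_expE mnm_sumE (bigD1 z) //= [X in (_ + X)%N]big1 ?addn0 => [|x xz].
    rewrite mnm_sumE /height /filled big_mkcond [RHS]big_mkcond; apply: eq_bigr => y _.
    by rewrite mnm1E eqxx andbC; case: ltnP => //=; case: eqP.
  by rewrite mnm_sumE big1 // => y _; rewrite mnm1E (negbTE xz).
apply: (big_ind2 leads); [exact: leads1 | exact: leadsM |] => x _.
apply: (big_ind2 leads); [exact: leads1 | by move=> *; apply: leadsM |].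
by move=> y /andP[/eqP cxy sxy]; apply: Flead.
Qed.

End Leads.

(** The weights in the closed chamber of the order s, and in its interior. *)
Definition nondecreasing_along s w := forall x y, (s x < s y)%N -> w 0 x <= w 0 y.
Definition increasing_along s w := forall x y, (s x < s y)%N -> w 0 x < w 0 y.

Lemma increasing_nondecreasing s w : increasing_along s w -> nondecreasing_along s w.
Proof. by move=> sw x y /sw/ltW. Qed.

Definition vdm_along s c : mpoly n K := oprod K (fun y x => (s y < s x)%N) c.

Lemma orients_rank s c : orients c (fun y x => (s y < s x)%N).
Proof.
by move=> x y _; rewrite -leqNgt ltn_neqAle (inj_eq val_inj) (inj_eq perm_inj).
Qed.

Lemma vdm_along_sign s c : vdm_along s c = vdm K c \/ vdm_along s c = - vdm K c.
Proof. exact: oprod_sign (orients_rank s (c := c)) (@orients_ltn _ c). Qed.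

Lemma vdm_along_leads s c :
  leads (nondecreasing_along s) (increasing_along s) (vdm_along s c) (lead_exp s c).
Proof.
apply: leads_prod => x y _ syx; rewrite /leads addrAC subrr add0r.
apply: supportedN; apply: supportedX.
by split=> w sw; rewrite !weight1; apply: sw.
Qed.

(** The initial form of the difference of x and y. *)
Definition init_pair w x y : mpoly n K :=
  if w 0 y < w 0 x then var x else if w 0 x < w 0 y then - var y else var x - var y.

Definition init_prod w (o : rel 'I_n) c : mpoly n K :=
  \prod_x \prod_(y | (c y == c x) && o y x) init_pair w x y.

Definition top_weight w (o : rel 'I_n) c : R :=
  \sum_x \sum_(y | (c y == c x) && o y x) Num.max (w 0 x) (w 0 y).

(** A multiplicative substitute for initial forms, with a bound W given in
    advance. *)
Definition initial_part w W f g :=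
  supported (fun m => weight w m <= W) f /\ component w W f = g.

Lemma initial_partM w W W' f f' g g' : initial_part w W f g ->
  initial_part w W' f' g' -> initial_part w (W + W') (f * f') (g * g').
Proof.
move=> [fW <-] [fW' <-]; split; last exact: componentM.
by apply: supportedM fW fW' => m m' ? ?; rewrite weightD lerD.
Qed.

Lemma initial_part1 w : initial_part w 0 1 1.
Proof.
have s1 : supported (fun m => weight w m = 0) (1 : mpoly n K).
  rewrite -mpolyX0; apply: supportedX; rewrite /weight big1 // => x _.
  by rewrite mnm0E mul0r.
by split; [apply: supported_sub s1 => m -> | rewrite component_id].
Qed.

Lemma initial_part_pair w x y :
  initial_part w (Num.max (w 0 x) (w 0 y)) (var x - var y) (init_pair w x y).
Proof.
have sv z : supported (fun m => weight w m = w 0 z) (var z).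
  by apply: supportedX; rewrite weight1.
split.
  apply: supportedB; [apply: supported_sub (sv x)|apply: supported_sub (sv y)] => m ->.
    by rewrite le_max lexx.
  by rewrite le_max lexx orbT.
rewrite componentB /init_pair; case: (ltgtP (w 0 x) (w 0 y)) => xy.
- rewrite (component_id (sv y)) [component _ _ (var x)]component_low ?sub0r //.
  by apply: supported_sub (sv x) => m ->.
- rewrite (component_id (sv x)) [component _ _ (var y)]component_low ?subr0 //.
  by apply: supported_sub (sv y) => m ->.
by have svy := sv y; rewrite -xy in svy; rewrite !component_id //; apply: sv.
Qed.

Lemma initial_part_oprod w o c :
  initial_part w (top_weight w o c) (oprod K o c) (init_prod w o c).
Proof.
rewrite /init_prod /oprod /top_weight.
have big3 (I : finType) (P : pred I) (W : I -> R) F G :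
    (forall i, P i -> initial_part w (W i) (F i) (G i)) ->
    initial_part w (\sum_(i | P i) W i) (\prod_(i | P i) F i) (\prod_(i | P i) G i).
  move=> H; apply: (big_rec3 (fun g f v => initial_part w v f g)).
    exact: initial_part1.
  by move=> i g f v Pi; apply: initial_partM (H i Pi).
by apply: (@big3) => x _; apply: (@big3) => y _; apply: initial_part_pair.
Qed.

Lemma init_prod_neq0 w o c : (forall x, ~~ o x x) -> init_prod w o c != 0.
Proof.
move=> oxx; apply/prodf_neq0 => x _; apply/prodf_neq0 => y /andP[_ oyx].
have xy : x != y by apply: contraTneq oyx => ->; apply: oxx.
have X0 z : var z != 0 by rewrite -msupp_eq0 msuppX.
rewrite /init_pair; case: ifP => _; first exact: X0.
case: ifP => _; first by rewrite oppr_eq0 X0.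
by rewrite subr_eq0; apply: contraNneq xy => /var_inj ->.
Qed.

Lemma initial_partP w W f g : g != 0 -> initial_part w W f g -> initial_form w f = g.
Proof.
move=> g0 [fW fg]; have [e [eg _]] := max_weight w g0.
have eW : weight w e = W by apply: (component_supp (f := f)); rewrite fg.
rewrite -fg -eW; apply: initial_formE; last by rewrite eW.
by move: eg; rewrite -fg !mcoeff_msupp mcoeff_component; case: ifP => //; rewrite eqxx.
Qed.

Lemma initial_form_vdm w c : initial_form w (vdm K c) = init_prod w (fun x y => (x < y)%N) c.
Proof.
apply: initial_partP (initial_part_oprod _ _ _); apply: init_prod_neq0 => x.
by rewrite ltnn.
Qed.

Lemma top_weight_lead s w c : nondecreasing_along s w ->
  top_weight w (fun y x => (s y < s x)%N) c = weight w (lead_exp s c).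
Proof.
move=> sw; rewrite /top_weight /weight; apply: eq_bigr => x _.
rewrite lead_expE /height /filled natr_sum mulr_suml big_mkcond [RHS]big_mkcond.
apply: eq_bigr => y _; rewrite andbC; case: (ltnP (s y)) => //= syx.
by case: (c y == c x); rewrite ?mul0r // mul1r; apply/max_idPl/sw.
Qed.

Lemma init_prod_sign w s c : init_prod w (fun y x => (s y < s x)%N) c =
    init_prod w (fun x y => (x < y)%N) c \/
  init_prod w (fun y x => (s y < s x)%N) c = - init_prod w (fun x y => (x < y)%N) c.
Proof.
have oprodE o : (forall x, ~~ o x x) -> initial_form w (oprod K o c) = init_prod w o c.
  by move=> oxx; apply: initial_partP (initial_part_oprod _ _ _); apply: init_prod_neq0.
have s1 : initial_form w (vdm_along s c) = init_prod w (fun y x => (s y < s x)%N) c.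
  by apply: oprodE => x; rewrite ltnn.
have [fW fE] := initial_part_oprod w (fun x y => (x < y)%N) c.
rewrite -s1; have [->|->] := vdm_along_sign s c; [left|right]; first exact: initial_form_vdm.
apply: (@initial_partP _ (top_weight w (fun x y => (x < y)%N) c)).
  by rewrite oppr_eq0; apply: init_prod_neq0 => x; rewrite ltnn.
by split; [apply: supportedN | rewrite componentN fE].
Qed.

End LeadingTerms.

(** * The Groebner basis *)

Section GroebnerBasis.
Variables (R : realType) (K : fieldType) (n : nat) (beta : 'I_n -> nat).
Variable I : set (mpoly n K).
Implicit Types (f g r : mpoly n K) (m e : multinom n) (w u : 'rV[R]_n) (W : R).
Implicit Types (s : {perm 'I_n}) (c : 'I_n -> 'I_n).
Local Notation mon m := (mpolyX K m).
Local Notation var x := (mpolyX K (mnm1 x)).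
Hypothesis I_ideal : is_ideal I.
Hypothesis I_vdm : forall c, dominated (class_size c) beta -> I (vdm K c).
Hypothesis I_vanish : forall f (a : 'I_n -> {poly K}) (v : nat -> {poly K}),
  I f -> injective v -> mmap (@polyC K) a f != 0 ->
  forall k, (\sum_(l < k) \sum_x (a x == v l) <= cap beta k)%N.

(** Divisible by the leading monomial, in the order s, of vdm c for some c of
    dominated shape. The other monomials are the standard ones. *)
Definition reducible s e :=
  exists c, dominated (class_size c) beta /\ forall x, (height s c x <= e x)%N.
Definition std s e := ~ reducible s e.

(** The greedy filling decides whether a monomial is reducible, being the
    smallest one in the dominance order. *)
Lemma reducible_greedy s e c : greedy s e c -> reducible s e ->
  dominated (class_size c) beta.
Proof.
move=> gc [c0 [c0beta c0e]] k; apply: leq_trans (c0beta k).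
rewrite -(eq_cap (filled_full s c)) -(eq_cap (filled_full s c0)).
by apply: (greedy_dominated (e := e)).
Qed.

(** Standard monomials are linearly independent modulo I: the lexicographic
    leading exponent e of f is standard, so the greedy filling of e is not
    dominated by beta, and f does not vanish at a point whose multiplicities
    are too large for the elements of I. *)
Lemma std_zero s f : I f -> supported (std s) f -> f = 0.
Proof.
move=> If fstd; apply/eqP; apply: contrapT => /negP f0.
have [e emax] := lex_max_exists s f0; have [c gc] := greedy_exists s e.
(* K may be finite: the values are taken among the powers of an indeterminate. *)
pose v0 l : {poly K} := 'X^l.
have v0_inj : injective v0.
  by move=> l l' /(congr1 (fun p : {poly K} => size p)); rewrite !size_polyXn => -[].
have [a [v [vi fa cap_le]]] := nonvanishing (@polyC K) v0_inj emax gc.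
case: (fstd e (proj1 emax)); exists c; split; last by move=> x; case: (gc x).
by move=> k; apply: leq_trans (cap_le k) (I_vanish If vi fa k).
Qed.

(** The ideal generated by the initial forms of the polynomials vdm c. *)
Definition initial_gen w : set (mpoly n K) :=
  ideal_gen [set g | exists c, dominated (class_size c) beta /\
    g = init_prod K w (fun x y => (x < y)%N) c].

Lemma initial_gen_ideal w : is_ideal (initial_gen w).
Proof. exact: ideal_gen_ideal. Qed.

Lemma vdm_along_in s c : dominated (class_size c) beta -> I (vdm_along K s c).
Proof.
move=> cb; have [->|->] := vdm_along_sign K s c; first exact: I_vdm.
by apply: idealN => //; apply: I_vdm.
Qed.

Lemma init_prod_in w s c : dominated (class_size c) beta ->
  initial_gen w (init_prod K w (fun y x => (s y < s x)%N) c).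
Proof.
move=> cb; have [->|->] := init_prod_sign K w s c.
  by apply: ideal_gen_in; exists c.
by apply: (idealN (ideal_gen_ideal _)); apply: ideal_gen_in; exists c.
Qed.

Section Reduction.
Variables (s : {perm 'I_n}) (C : 'rV[R]_n -> R -> Prop).

(** f is congruent modulo I to a combination r of standard monomials. For the
    weights w and bounds W in C, the reduction does not exceed W, and in weight
    W it takes place modulo the initial forms. *)
Definition reduces f := exists r, [/\ supported (std s) r, I (f - r) &
  forall w W, C w W -> supported (fun m => weight w m <= W) r /\
    initial_gen w (component w W (f - r))].

Lemma reduces0 : reduces 0.
Proof.
exists 0; split; [exact: supported0 | by rewrite subrr; case: I_ideal |].
move=> w W _; split; first exact: supported0.
by rewrite subrr component0; case: (initial_gen_ideal w).
Qed.

Lemma reducesD f g : reduces f -> reduces g -> reduces (f + g).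
Proof.
move=> [r [r1 r2 r3]] [r' [r1' r2' r3']]; exists (r + r').
have E : f + g - (r + r') = (f - r) + (g - r') by ring.
rewrite E; split; [exact: supportedD | by case: I_ideal => _ + _; apply |].
move=> w W wC; have [a b] := r3 w W wC; have [a' b'] := r3' w W wC.
split; first exact: supportedD.
by rewrite componentD; case: (initial_gen_ideal w) => _ + _; apply.
Qed.

Lemma reducesZ a f : reduces f -> reduces (a *: f).
Proof.
move=> [r [r1 r2 r3]]; exists (a *: r); rewrite -scalerBr.
split; [exact: supportedZ | exact: idealZ |].
move=> w W wC; have [x y] := r3 w W wC; split; first exact: supportedZ.
by rewrite componentZ; apply: idealZ => //; apply: ideal_gen_ideal.
Qed.

End Reduction.

Definition rank_row s : 'rV[R]_n := \row_x (s x)%:R.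

Lemma rank_row_increasing s : increasing_along s (rank_row s).
Proof. by move=> x y sxy; rewrite !mxE ltr_nat. Qed.

Lemma weight_rank s m : weight (rank_row s) m = (\sum_x m x * s x)%N%:R.
Proof. by rewrite /weight natr_sum; apply: eq_bigr => x _; rewrite mxE natrM. Qed.

Lemma reduces_weaken s (C C' : 'rV[R]_n -> R -> Prop) e :
  (forall w W, C' w W -> exists2 W', C w W' & W' <= W /\ weight w e <= W') ->
  reduces s C (mon e) -> reduces s C' (mon e).
Proof.
move=> CC' [r [r1 r2 r3]]; exists r; split=> // w W /CC'[W' wC [W'W eW']].
have [a b] := r3 w W' wC; split; first by apply: supported_sub a => m /le_trans; apply.
move: W'W; rewrite le_eqVlt => /orP[/eqP <- //|W'W].
rewrite component_low; first by case: (initial_gen_ideal w).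
apply: supportedB; first by apply: supportedX; apply: le_lt_trans W'W.
by apply: supported_sub a => m am; apply: le_lt_trans am W'W.
Qed.

(** Replacing a leading monomial by the other terms of a multiple of vdm c lowers
    the weight given by the ranks, so the reduction terminates; it raises no
    weight of the closed chamber of s. *)
Lemma mon_reduces s e : reduces s (fun w W => nondecreasing_along s w /\ W = weight w e) (mon e).
Proof.
have [N] := ubnP (\sum_x e x * s x)%N; elim: N e => [//|N IH] e; rewrite ltnS => eN.
have [[c [cb ce]]|irr] := pselect (reducible s e); last first.
  exists (mon e); split; [exact: supportedX | by rewrite subrr; case: I_ideal |].
  move=> w W [_ ->]; split; first exact: supportedX.
  by rewrite subrr component0; case: (initial_gen_ideal w).
pose d : multinom n := mnm_sub e (lead_exp s c).
have eE : e = mnm_add d (lead_exp s c).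
  by apply/mnmP => x; rewrite mnmDE mnmBE lead_expE subnK.
pose g := mon d * vdm_along K s c.
have glead : leads (@nondecreasing_along R n s) (increasing_along s) g e.
  by rewrite eE /g; apply: leadsM; [exact: leadsX | exact: vdm_along_leads].
have : reduces s (fun w W => nondecreasing_along s w /\ W = weight w e) (mon e - g).
  apply: mpoly_monomial_ind; [exact: reduces0 | exact: reducesD | exact: reducesZ |].
  rewrite -opprB; apply: supportedN; apply: supported_sub glead => m [m0 m1].
  apply: (reduces_weaken (C := fun w W => nondecreasing_along s w /\ W = weight w m)).
    by move=> w W [sw ->]; exists (weight w m) => //; split=> //; apply: m0.
  apply: IH; apply: leq_trans eN; rewrite -(ltr_nat R) -!weight_rank.
  apply: m1; apply: rank_row_increasing.
move=> [r [r1 r2 r3]]; exists r.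
have E : mon e - r = mon e - g - r + g by ring.
have Ig : I g by case: I_ideal => _ _; apply; apply: vdm_along_in.
split=> //; first by rewrite E; case: I_ideal => _ + _; apply.
move=> w W wC; have [a b] := r3 w W wC; split=> //; rewrite E componentD.
have [sw WE] := wC.
have Ji := initial_gen_ideal w.
case: (Ji) => _ JD JM; apply: JD => //; rewrite WE eE weightD -(top_weight_lead c sw).
have [v1 v2] := initial_part_oprod K w (fun y x => (s y < s x)%N) c.
rewrite componentM //; last by apply: supportedX.
by apply: JM; rewrite v2; apply: init_prod_in.
Qed.

Lemma poly_reduces s (C : 'rV[R]_n -> R -> Prop) f :
  (forall w W, C w W -> nondecreasing_along s w /\ supported (fun m => weight w m <= W) f) ->
  reduces s C f.
Proof.
move=> Cf; apply: mpoly_monomial_ind; [exact: reduces0 | exact: reducesD | exact: reducesZ |].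
move=> m mf; apply: reduces_weaken (mon_reduces s m) => w W /Cf [sw fW].
by exists (weight w m) => //; split=> //; apply: fW.
Qed.

(** Every weight lies in some closed chamber, and ties may be broken at will. *)
Lemma order_exists w (t : {perm 'I_n}) : exists s : {perm 'I_n}, nondecreasing_along s w /\
  forall x y, w 0 x = w 0 y -> (s x < s y)%N = (t x < t y)%N.
Proof.
have [|||s sE] := @perm_of_order n
    (fun x y => (w 0 x < w 0 y) || (w 0 x == w 0 y) && (t x < t y)%N).
- by move=> x; rewrite ltxx ltnn andbF.
- move=> y x z /orP[xy|/andP[/eqP-> xy]] /orP[yz|/andP[/eqP<- yz]].
  + by rewrite (lt_trans xy yz).
  + by rewrite xy.
  + by rewrite yz.
  + by rewrite eqxx (ltn_trans xy yz) orbT.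
- move=> x y xy; case: ltgtP => //= _.
  by rewrite -neq_ltn (inj_eq val_inj) (inj_eq perm_inj).
exists s; split=> [x y|x y xy].
  by rewrite sE => /orP[/ltW|/andP[/eqP->]].
by rewrite sE xy ltxx eqxx.
Qed.

Lemma initial_gen_component w W f : I f -> supported (fun m => weight w m <= W) f ->
  initial_gen w (component w W f).
Proof.
move=> If fW; have [s [sw _]] := order_exists w 1%g.
have [|r [r1 r2 r3]] := @poly_reduces s (fun w' W' => w' = w /\ W' = W) f.
  by move=> _ _ [-> ->].
have r0 : r = 0.
  apply: std_zero r1; have -> : r = f - (f - r) by ring.
  exact: idealB.
by have [_] := r3 w W (conj erefl erefl); rewrite r0 subr0.
Qed.

(** The polynomials vdm c with c of dominated shape are a universal Groebner
    basis: an element of I reduces to 0, since standard monomials are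
    independent, and in the top weight this happens modulo their initial
    forms. *)
Theorem initial_ideal_gen w : initial_ideal w I = initial_gen w.
Proof.
apply/seteqP; split; apply: ideal_gen_min; try exact: ideal_gen_ideal.
  move=> g [f If <-]; have [->|f0] := eqVneq f 0.
    by rewrite initial_form0; case: (initial_gen_ideal w).
  have [e [ef fe]] := max_weight w f0.
  by rewrite (initial_formE ef fe); apply: initial_gen_component.
move=> g [c [cb ->]]; apply: ideal_gen_in; exists (vdm K c); first exact: I_vdm.
exact: initial_form_vdm.
Qed.

(** Replace the lower terms of g by standard ones: if e were standard too, this
    would produce a nonzero element of V supported on standard monomials. *)
Lemma lead_not_std (V : set (mpoly n K)) (Std : multinom n -> Prop) u :
  V 0 -> (forall f g, V f -> V g -> V (f + g)) -> (forall a f, V f -> V (a *: f)) ->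
  (forall f, V f -> supported Std f -> f = 0) ->
  (forall m, exists r, [/\ supported Std r, V (mon m - r) &
     supported (fun m' => weight u m' <= weight u m) r]) ->
  forall g e, V g -> supported (fun m => weight u m < weight u e) (g - mon e) -> ~ Std e.
Proof.
move=> V0 VD VZ Vstd Vred g e Vg ge Se.
have [r [r1 r2 r3]] : exists r, [/\ supported Std r, V (g - mon e - r) &
    supported (fun m' => weight u m' < weight u e) r].
  apply: (mpoly_monomial_ind (V := fun h => exists r, [/\ supported Std r, V (h - r) &
    supported (fun m' => weight u m' < weight u e) r])).
  - by exists 0; rewrite subr0; split=> //; apply: supported0.
  - move=> f h [r [r1 r2 r3]] [r' [r1' r2' r3']]; exists (r + r').
    have -> : f + h - (r + r') = (f - r) + (h - r') by ring.
    by split; [apply: supportedD | apply: VD | apply: supportedD].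
  - move=> a f [r [r1 r2 r3]]; exists (a *: r); rewrite -scalerBr.
    by split; [apply: supportedZ | apply: VZ | apply: supportedZ].
  apply: supported_sub ge => m me; have [r [r1 r2 r3]] := Vred m.
  by exists r; split=> //; apply: supported_sub r3 => m' /le_lt_trans; apply.
have Ver : V (mon e + r).
  have -> : mon e + r = g + -1 *: (g - mon e - r) by rewrite scaleN1r; ring.
  by apply: VD => //; apply: VZ.
have er0 : mon e + r = 0.
  by apply: Vstd => //; apply: supportedD => //; apply: supportedX.
have : mcoeff e (mon e + r) == 0 by rewrite er0 mcoeff0.
rewrite mcoeffD mcoeffX eqxx.
have /memN_msupp_eq0 -> : e \notin msupp r by apply/negP => /r3; rewrite ltxx.
by rewrite addr0 oner_eq0.
Qed.

(** An inclusion between two sets of standard monomials is an equality, because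
    both are bases modulo the same ideal. *)
Lemma reducible_sym s s' : (forall e, reducible s e -> reducible s' e) ->
  forall e, reducible s' e -> reducible s e.
Proof.
move=> ss' e e'; apply: contrapT => estd.
have [r [r1 r2 _]] := mon_reduces s' e.
have er0 : mon e - r = 0.
  apply: (std_zero (s := s)) => //; apply: supportedB; first exact: supportedX.
  by apply: supported_sub r1 => m; apply: contra_not => /ss'.
apply: (r1 e) => //; have -> : r = mon e by apply/esym/eqP; rewrite -subr_eq0 er0.
by rewrite msuppX mem_head.
Qed.

(** Weight by weight, a combination of initial forms lifts to the same
    combination of the elements of I that they come from. *)
Lemma initial_gen_lift w W h : initial_gen w h ->
  exists F, I F /\ supported (fun m => weight w m < W) (F - component w W h).
Proof.
pose V : set (mpoly n K) := fun h => forall W,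
  exists F, I F /\ supported (fun m => weight w m < W) (F - component w W h).
have [I0 ID IM] := I_ideal.
suff VJ : forall h, initial_gen w h -> V h by move=> /VJ.
have V0 : V 0 by move=> W'; exists 0; rewrite component0 subrr; split=> //; apply: supported0.
have VD f g : V f -> V g -> V (f + g).
  move=> Vf Vg W'; have [F [IF Fl]] := Vf W'; have [G [IG Gl]] := Vg W'.
  exists (F + G); split; first exact: ID.
  rewrite componentD; have -> : F + G - (component w W' f + component w W' g) =
    (F - component w W' f) + (G - component w W' g) by ring.
  exact: supportedD.
have VZ a f : V f -> V (a *: f).
  move=> Vf W'; have [F [IF Fl]] := Vf W'; exists (a *: F); split; first exact: idealZ.
  by rewrite componentZ -scalerBr; apply: supportedZ.
apply: ideal_gen_min.
  split=> // a f Vf; apply: (mpoly_monomial_ind (V := fun a => V (a * f))).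
  - by rewrite mul0r.
  - by move=> g g' Vg Vg'; rewrite mulrDl; apply: VD.
  - by move=> k g Vg; rewrite -scalerAl; apply: VZ.
  move=> m _ W'; have [F [IF Fl]] := Vf (W' - weight w m).
  exists (mon m * F); split; first exact: IM.
  have -> : component w W' (mon m * f) = mon m * component w (W' - weight w m) f.
    apply/mpolyP => m'; rewrite mcoeff_component ![mon m * _]mulrC.
    have [mm|mm] := boolP [forall x, (m x <= m' x)%N].
      have -> : m' = mnm_add m (mnm_sub m' m).
        by apply/mnmP => x; rewrite mnmDE mnmBE subnKC // (forallP mm).
      rewrite !mcoeffMX mcoeff_component weightD [_ + weight w (mnm_sub _ _)]addrC.
      by rewrite -[W' in LHS](subrK (weight w m)) (inj_eq (addIr _)).
    have noM p : mcoeff m' (p * mon m) = 0.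
      apply/eqP; rewrite mcoeff_eq0; apply: contra mm.
      rewrite (perm_mem (msuppMX _ _)) => /mapP[m1 _ ->].
      by apply/forallP => x; rewrite mnmDE leq_addr.
    by rewrite !noM if_same.
  rewrite -mulrBr; apply: (supportedM _ (supportedX (Q := eq^~ m) erefl) Fl).
  by move=> _ m' -> lt; rewrite weightD addrC -ltrBrDr.
move=> _ [c [cb ->]] W'.
have [v1 v2] := initial_part_oprod K w (fun x y => (x < y)%N) c.
have sW := component_supp (w := w) (W := top_weight w (fun x y => (x < y)%N) c)
  (f := vdm K c).
rewrite v2 in sW.
have [->|neW] := eqVneq W' (top_weight w (fun x y => (x < y)%N) c).
  exists (vdm K c); split; first exact: I_vdm.
  by rewrite component_id // -v2; apply: component_rest.
exists 0; split=> //; suff -> : component w W' (init_prod K w (fun x y => (x < y)%N) c) = 0.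
  by rewrite subrr; apply: supported0.
apply/mpolyP => m; rewrite mcoeff_component mcoeff0; case: eqP => // mW.
apply/eqP; rewrite mcoeff_eq0; apply: contra neW => /sW <-.
by rewrite mW.
Qed.

(** A relation between standard monomials modulo the initial ideal would lift to
    one modulo I with the same leading component. *)
Lemma std_zero_initial w s h : nondecreasing_along s w -> initial_gen w h ->
  supported (std s) h -> h = 0.
Proof.
move=> sw Jh hstd; apply/eqP; apply: contrapT => /negP h0.
have [m [mh hm]] := max_weight w h0; set W := weight w m in hm.
have [F [IF Fl]] := initial_gen_lift W Jh.
have [r [r1 r2 r3]] : exists r, [/\ supported (std s) r, I (F - component w W h - r) &
    supported (fun m' => weight w m' < W) r].
  have [->|l0] := eqVneq (F - component w W h) 0.
    by exists 0; rewrite subrr; split; [apply: supported0|case: I_ideal|apply: supported0].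
  have [m0 [m0l lm0]] := max_weight w l0.
  have [|r [r1 r2 r3]] := @poly_reduces s (fun w' W' => w' = w /\ W' = weight w m0)
      (F - component w W h).
    by move=> _ _ [-> ->].
  exists r; split=> //; have [a _] := r3 w _ (conj erefl erefl).
  by apply: supported_sub a => m' /le_lt_trans; apply; apply: Fl.
have hr0 : component w W h + r = 0.
  apply: (std_zero (s := s)).
    have -> : component w W h + r = F - (F - component w W h - r) by ring.
    exact: idealB.
  by apply: supportedD => //; apply: component_sub.
have : mcoeff m (component w W h + r) == 0 by rewrite hr0 mcoeff0.
rewrite mcoeffD mcoeff_component eqxx.
have /memN_msupp_eq0 -> : m \notin msupp r by apply/negP => /r3; rewrite ltxx.
by rewrite addr0 mcoeff_eq0 mh.
Qed.

(** The initial ideal determines the set of standard monomials for every order s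
    compatible with w: the leading monomials for s are those of the initial
    forms, for an order that breaks the ties of w like s. *)
Lemma initial_gen_reducible w w' (s s' : {perm 'I_n}) :
  initial_gen w = initial_gen w' -> nondecreasing_along s w -> nondecreasing_along s' w' ->
  (forall x y, w 0 x = w 0 y -> (s x < s y)%N = (s' x < s' y)%N) ->
  forall e, reducible s e -> reducible s' e.
Proof.
move=> ww' sw s'w' tie e [c [cb ce]]; apply: contrapT => estd.
have [J0 JD JM] := initial_gen_ideal w'.
have JZ a f : initial_gen w' f -> initial_gen w' (a *: f) by apply: idealZ.
pose u : 'rV[R]_n := rank_row s'.
pose d : multinom n := mnm_sub e (lead_exp s c).
have eE : e = mnm_add d (lead_exp s c).
  by apply/mnmP => x; rewrite mnmDE mnmBE lead_expE subnK.
pose g := mon d * init_prod K w (fun y x => (s y < s x)%N) c.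
have glead : leads (fun u' => u' = u) (fun u' => u' = u) g e.
  rewrite eE /g; apply: leadsM; first exact: leadsX.
  apply: leads_prod => x y _ syx; rewrite /init_pair.
  have := sw _ _ syx; case: ltgtP => // [wyx|wyx] _; first exact: leadsX.
  rewrite /leads addrAC subrr add0r; apply: supportedN; apply: supportedX.
  have s'yx : (s' y < s' x)%N by rewrite -tie.
  by split=> _ ->; rewrite !weight1 !mxE ?ler_nat ?ltr_nat // ltnW.
apply: (@lead_not_std (initial_gen w') (std s') u J0 JD JZ _ _ g e) => //.
- by move=> h Jh hstd; apply: (std_zero_initial s'w' Jh hstd).
- move=> m; have [r [r1 r2 r3]] := mon_reduces s' m.
  have [a b] := r3 w' _ (conj s'w' erefl).
  have [a' _] := r3 u _ (conj (increasing_nondecreasing (rank_row_increasing (s := s'))) erefl).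
  exists (component w' (weight w' m) r); split; try exact: component_sub.
  by move: b; rewrite componentB component_id //; apply: supportedX.
- by rewrite -ww'; case: (initial_gen_ideal w) => _ _; apply; apply: init_prod_in.
- by apply: supported_sub glead => m [_]; apply.
Qed.

(** This is the convexity of Groebner cells. The normal form is the same for s
    and s', so it does not increase the weights of both closed chambers, nor
    their sums; and some such sum lies in the open chamber of the order obtained
    from s by exchanging its neighbours a and b, which s' orders differently. *)
Lemma swap_reducible s s' a b : (s b).+1 = s a :> nat -> (s' a < s' b)%N ->
  (forall e, reducible s e -> reducible s' e) ->
  forall e, reducible (tperm a b * s)%g e -> reducible s e.
Proof.
move=> sab s'ab ss' e [c [cb ce]]; apply: contrapT => estd.
have [I0 ID IM] := I_ideal; set s3 := (_ * _)%g in ce.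
pose z x := if x == a then s b else s x.
(* u0 lies on the wall where a and b are equal, and the factor n gives it
   priority over the ranks of s'. *)
pose u0 : 'rV[R]_n := \row_x (z x)%:R.
pose u : 'rV[R]_n := n%:R *: u0 + rank_row s'.
have ab : a != b by apply: contraTneq s'ab => ->; rewrite ltnn.
have s_neq x y : x != y -> s x != s y :> nat.
  by rewrite (inj_eq val_inj) (inj_eq perm_inj).
have wu0 : nondecreasing_along s u0.
  move=> x y sxy; rewrite !mxE ler_nat /z; case: eqVneq => [xa|xa]; case: eqVneq => [ya|ya] //.
  - by rewrite xa in sxy; lia.
  - by rewrite ya in sxy; lia.
  - exact: ltnW.
have su : increasing_along s3 u.
  move=> x y; rewrite !mxE -!natrM -!natrD ltr_nat !permM.
  have ba : (b == a) = false by rewrite eq_sym (negbTE ab).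
  have xn := ltn_ord (s' x).
  suff zz : (s (tperm a b x) < s (tperm a b y))%N -> (z x < z y)%N \/ x = a /\ y = b.
    by move/zz => [|[-> ->]]; rewrite /z ?eqxx ?ba; nia.
  rewrite /z; case: tpermP => [->|->|/eqP xa /eqP xb];
    case: tpermP => [->|->|/eqP ya /eqP yb];
    rewrite ?eqxx ?ba ?(negbTE xa) ?(negbTE ya) => lt; try (by right); left; try lia.
  by have := s_neq _ _ xb; lia.
pose d : multinom n := mnm_sub e (lead_exp s3 c).
have eE : e = mnm_add d (lead_exp s3 c).
  by apply/mnmP => x; rewrite mnmDE mnmBE lead_expE subnK.
pose g := mon d * vdm_along K s3 c.
have glead : leads (@nondecreasing_along R n s3) (increasing_along s3) g e.
  by rewrite eE /g; apply: leadsM; [exact: leadsX | exact: vdm_along_leads].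
apply: (@lead_not_std I (std s) u I0 ID (fun a f => @idealZ _ _ _ a f I_ideal) _ _ g e) => //.
- by move=> f If fs; apply: std_zero fs.
- move=> m; have [r [r1 r2 r3]] := mon_reduces s m.
  have [r' [r1' r2' r3']] := mon_reduces s' m.
  have rr' : r = r'.
    apply/eqP; rewrite -subr_eq0; apply/eqP; apply: (std_zero (s := s)).
      have -> : r - r' = (mon m - r') - (mon m - r) by ring.
      exact: idealB.
    by apply: supportedB => //; apply: supported_sub r1' => m' ms' /ss'.
  exists r; split=> // m' m'r; rewrite !weight_lin lerD //.
    apply: ler_wpM2l => //; exact: (proj1 (r3 u0 _ (conj wu0 erefl))).
  rewrite rr' in m'r; apply: (proj1 (r3' _ _ (conj _ erefl))) => //.
  by apply: increasing_nondecreasing; apply: rank_row_increasing.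
- by case: I_ideal => _ _; apply; apply: vdm_along_in.
- by apply: supported_sub glead => m [_]; apply.
Qed.

End GroebnerBasis.

(** * Specht ideals *)

Lemma sum_le1 (T : finType) (P : pred T) :
  (forall x y, P x -> P y -> x = y) -> (\sum_x P x <= 1)%N.
Proof.
move=> P1; have [/existsP[x Px]|/existsPn no] := boolP [exists x, P x].
  rewrite (bigD1 x) //= big1 ?addn0 ?leq_b1 // => y yx.
  by case Py: (P y) => //; rewrite (P1 y x Py Px) eqxx in yx.
by rewrite big1 // => x _; rewrite (negbTE (no x)).
Qed.

Section Tableaux.
Variables (K : fieldType) (n : nat) (lam : seq nat).
Hypotheses (lam_sorted : sorted geq lam) (lam_sum : sumn lam = n).

(** The conjugate partition. *)
Definition col_height (j : 'I_n) := count (fun l => (j < l)%N) lam.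

Lemma nth_lam_le i : (nth 0%N lam i <= n)%N.
Proof.
rewrite -lam_sum; elim: lam i => [|a r IH] [|i] //=; first exact: leq_addr.
exact: leq_trans (IH i) (leq_addl _ _).
Qed.

Lemma ltn_nth_lam i j : (j < nth 0%N lam i)%N = (i < count (fun l => (j < l)%N) lam)%N.
Proof.
elim: lam lam_sorted i => [|a r IH] /= srt i; first by rewrite nth_nil.
have ar : all (fun l => (l <= a)%N) r by apply: order_path_min srt => ? ? ? ? /leq_trans; apply.
have {}IH := IH (path_sorted srt).
have [ja|aj] := ltnP j a.
  by case: i => [|i] //=; rewrite add1n ltnS.
have -> : count (fun l => (j < l)%N) r = 0%N.
  by apply/eqP; rewrite -leqn0 leqNgt -has_count; apply/hasPn => l /(allP ar); lia.
case: i => [|i] /=; first by lia.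
have [/(mem_nth 0%N)/(allP ar) /=|ri] := ltnP i (size r); first by lia.
by rewrite nth_default //; lia.
Qed.

Lemma col_heightP i (j : 'I_n) : (j < nth 0%N lam i)%N = (i < col_height j)%N.
Proof. exact: ltn_nth_lam. Qed.

Lemma col_height_mono (i j : 'I_n) : (i <= j)%N -> (col_height j <= col_height i)%N.
Proof. by move=> ij; apply: sub_count => l /=; apply: leq_ltn_trans. Qed.

Lemma sum_col_height : (\sum_j col_height j = n)%N.
Proof.
rewrite /col_height; under eq_bigr do rewrite -sum1_count big_mkcond.
rewrite exchange_big /= -[RHS]lam_sum sumnE; apply: eq_big_seq => l ll.
have ln : (l <= n)%N by have := nth_lam_le (index l lam); rewrite nth_index.
by rewrite -big_mkcond /= -(big_ord_widen n (fun=> 1%N)) // sum1_card card_ord.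
Qed.

Definition box_col (b : young_box lam) : nat := tagged b.

Lemma box_col_lt b : (box_col b < n)%N.
Proof. exact: leq_trans (ltn_ord _) (nth_lam_le _). Qed.

Lemma box_eq (b b' : young_box lam) : tag b = tag b' :> nat -> box_col b = box_col b' -> b = b'.
Proof.
case: b b' => [i j] [i' j'] /= /val_inj ii'; subst i' => /= jj'.
by congr existT; apply: val_inj.
Qed.

Section OneTableau.
Variables (T : young_box lam -> 'I_n) (g : 'I_n -> young_box lam).
Hypotheses (TK : cancel T g) (gK : cancel g T).

Definition coloring_of x : 'I_n := Ordinal (box_col_lt (g x)).
Definition row_order : rel 'I_n := fun y x => (tag (g x) < tag (g y))%N.

(** Along a column, the row index orders the entries. *)
Lemma orients_row : orients coloring_of row_order.
Proof.
move=> x y /(congr1 val) /= cxy; rewrite /row_order -leqNgt ltn_neqAle.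
congr (_ && _); congr (~~ _); apply/eqP/eqP => [/esym gxy|->//].
by rewrite -(gK x) -(gK y) (box_eq gxy).
Qed.

Lemma specht_oprod : specht_poly K T = oprod K row_order coloring_of.
Proof.
rewrite /specht_poly /oprod (reindex g) /=; last by exists T => ? _.
apply: eq_bigr => x _; rewrite (reindex g) /=; last by exists T => ? _.
by apply: eq_big => [y|y _]; rewrite ?gK // eq_sym.
Qed.

Lemma specht_vdm : specht_poly K T = vdm K coloring_of \/ specht_poly K T = - vdm K coloring_of.
Proof. by rewrite specht_oprod; apply: oprod_sign orients_row (@orients_ltn _ _). Qed.

Lemma coloring_of_size j : class_size coloring_of j = col_height j.
Proof.
rewrite /class_size (reindex T) /=; last by exists g => ? _.
under eq_bigr do rewrite -(inj_eq val_inj) /= TK.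
rewrite -(sig_big_dep (fun=> true) (fun _ => xpredT)
  (fun (i : 'I_(size lam)) (l : 'I_(nth 0%N lam i)) => (l == j :> nat) : nat)) /=.
rewrite /col_height -sum1_count (big_nth 0%N) big_mkord [RHS]big_mkcond /=.
apply: eq_bigr => i _; have [ji|ij] := ltnP j (nth 0%N lam i).
  rewrite (bigD1 (Ordinal ji)) //= eqxx big1 // => l.
  by rewrite -(inj_eq val_inj) /= => /negbTE->.
by rewrite big1 // => l _; have := ltn_ord l; case: eqP => // ->; rewrite ltnNge ij.
Qed.

End OneTableau.

Lemma specht_ideal_ideal : is_ideal (specht_ideal K n lam).
Proof. exact: ideal_gen_ideal. Qed.

(** A Specht polynomial vanishes unless the coordinates are distinct along each
    column, and then k values are taken at most min (h, k) times in a column of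
    height h. *)
Lemma specht_ideal_vanish f (a : 'I_n -> {poly K}) (v : nat -> {poly K}) :
  specht_ideal K n lam f -> injective v -> mmap (@polyC K) a f != 0 ->
  forall k, (\sum_(l < k) \sum_x (a x == v l) <= cap col_height k)%N.
Proof.
move=> [N [b [p [pT ->]]]] vi.
rewrite rmorph_sum /= => fa k.
have [i pa] : exists i, mmap (@polyC K) a (p i) != 0.
  apply/existsP; apply: contraNT fa => /existsPn no; rewrite big1 // => i _.
  by rewrite rmorphM /= (eqP (negbNE (no i))) mulr0.
have [T [[g TK gK] pE]] := pT i.
have {pa} ca : mmap (@polyC K) a (vdm K (coloring_of g)) != 0.
  move: pa; rewrite pE; have [->|->] // := specht_vdm TK gK.
  by rewrite rmorphN oppr_eq0.
set c := coloring_of g in ca.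
have a_inj x y : c x = c y -> a x = a y -> x = y.
  move=> cxy axy; apply/eqP; apply: contraNT ca => xy.
  rewrite /vdm /oprod rmorph_prod /=.
  wlog yx : x y cxy axy xy / (y < x)%N.
    move=> H; have := xy; rewrite -(inj_eq val_inj) neq_ltn => /orP[|]; last exact: H.
    by apply: H; rewrite // eq_sym.
  rewrite (bigD1 x) //= rmorph_prod (bigD1 y) /=; last by rewrite cxy eqxx.
  by rewrite rmorphB /= !mmapX !mmap1U axy subrr !mul0r.
rewrite /cap; under [leqRHS]eq_bigr do rewrite -(coloring_of_size TK gK) -/c.
rewrite (eq_bigr (fun l : 'I_k => \sum_j \sum_(x | c x == j) (a x == v l))%N); last first.
  by move=> l _; rewrite (partition_big c predT).
rewrite exchange_big; apply: leq_sum => j _; rewrite leq_min; apply/andP; split.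
  rewrite exchange_big /class_size big_mkcond; apply: leq_sum => x _; case: eqP => //= _.
  by apply: sum_le1 => l l' /eqP -> /eqP /vi /val_inj.
rewrite -[leqRHS]card_ord -sum1_card; apply: leq_sum => l _.
rewrite big_mkcond /=.
rewrite (eq_bigr (fun x => ((c x == j) && (a x == v l)) : nat)).
  apply: sum_le1 => x y /andP[/eqP cx /eqP ax] /andP[/eqP cy /eqP ay].
  by apply: a_inj; rewrite ?cx ?ax.
by move=> x _; case: (c x == j).
Qed.

Lemma vdm_relabel c c' (pi : 'I_n -> 'I_n) : injective pi -> (forall x, c x = pi (c' x)) ->
  vdm K c = vdm K c'.
Proof.
move=> pi_inj cc'; apply: eq_bigr => x _; apply: eq_bigl => y.
by rewrite !cc' (inj_eq pi_inj).
Qed.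

(** Up to a permutation of the colors the classes have the sizes of the columns,
    and enumerating each class from top to bottom gives a tableau. *)
Lemma specht_ideal_shape c : cap (class_size c) =1 cap col_height ->
  specht_ideal K n lam (vdm K c).
Proof.
move=> capE.
have [pi piE] : exists pi : {perm 'I_n}, forall j, class_size c (pi j) = col_height j.
  pose heights F := [tuple F j | j < n] : n.-tuple nat.
  have count_heights (F : 'I_n -> nat) h : count_mem h (heights F) = (\sum_j (F j == h))%N.
    rewrite -sum1_count big_map big_mkcond /= big_enum /=.
    by apply: eq_bigr => j _; case: eqP.
  have : perm_eq (heights col_height) (heights (class_size c)).
    apply/allP => h _ /=; rewrite !count_heights; apply/eqP.
    by apply: count_height_eq => k; rewrite capE.
  case/tuple_permP => pi /val_inj piE; exists pi => j.
  by have := congr1 (fun t => tnth t j) piE; rewrite !tnth_mktuple.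
pose cls j := [seq x <- enum 'I_n | c x == pi j].
have size_cls j : size (cls j) = col_height j.
  rewrite -piE /cls size_filter -sum1_count big_mkcond /= big_enum /=.
  by [].
pose bcol (b : young_box lam) : 'I_n := Ordinal (box_col_lt b).
have row_lt (b : young_box lam) : (tag b < size (cls (bcol b)))%N.
  by rewrite size_cls -col_heightP; exact: (ltn_ord (tagged b)).
pose T b := nth (bcol b) (cls (bcol b)) (tag b).
have Tc b : c (T b) = pi (bcol b).
  have := mem_nth (bcol b) (row_lt b); rewrite -/(T b) mem_filter => /andP[/eqP -> _].
  by [].
have T_inj : injective T.
  move=> b b' TT; have cc : bcol b = bcol b'.
    by apply: (@perm_inj _ pi); rewrite -!Tc TT.
  apply: box_eq; last by have := congr1 val cc.
  have cls_uniq : uniq (cls (bcol b)) by apply/filter_uniq/enum_uniq.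
  move/eqP: TT; rewrite /T -cc (nth_uniq _ (row_lt b) _ cls_uniq) => [/eqP //|].
  by rewrite cc row_lt.
have T_bij : bijective T.
  apply: inj_card_bij => //; rewrite card_ord card_tagged sumnE big_map big_enum /=.
  rewrite -{1}lam_sum sumnE (big_nth 0%N) big_mkord; apply: leq_sum => i _.
  by rewrite card_ord.
have [g TK gK] := T_bij.
have cE : vdm K c = vdm K (coloring_of g).
  by apply: (vdm_relabel (pi := pi)) => [|x]; [exact: perm_inj | rewrite -{1}(gK x) Tc].
have If : specht_ideal K n lam (specht_poly K T).
  by apply: ideal_gen_in; exists T; split; [exists g|].
rewrite cE; have [<- //|E] := specht_vdm TK gK.
by rewrite -[vdm _ _]opprK -E; apply: idealN => //; apply: specht_ideal_ideal.
Qed.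

Lemma specht_ideal_vdm c : dominated (class_size c) col_height ->
  specht_ideal K n lam (vdm K c).
Proof.
have [I0 ID IM] := specht_ideal_ideal.
apply: (dominated_vdm (beta := col_height)) => //; first exact: sum_col_height.
exact: specht_ideal_shape.
Qed.

Hypothesis lam_last : (0 < last 0 lam)%N.

Lemma nth_lam_noninc i j : (i <= j)%N -> (j < size lam)%N ->
  (nth 0%N lam j <= nth 0%N lam i)%N.
Proof.
move=> ij jlt; have geq_trans : transitive geq by move=> x y z xy /leq_trans; apply.
apply: (sorted_leq_nth geq_trans leqnn 0%N lam_sorted) => //.
exact: leq_ltn_trans ij jlt.
Qed.

Lemma nth_lam_gt0 i : (i < size lam)%N -> (0 < nth 0%N lam i)%N.
Proof.
move=> ilt; have m_gt0 := leq_ltn_trans (leq0n i) ilt.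
apply: (leq_trans lam_last); rewrite -nth_last.
by apply: nth_lam_noninc; rewrite ?ltn_predL // -ltnS prednK.
Qed.

(** Rows t and t + 1, counted from 1, are equal exactly when no column has
    height t. *)
Lemma equal_rows_gap i : (2 <= i <= size lam)%N -> nth 0%N lam i.-1 = nth 0%N lam i.-2 ->
  [/\ (0 < i.-1)%N, forall j, col_height j != i.-1 & exists j, (i.-1 < col_height j)%N].
Proof.
case: i => [//|[//|t]] /= tm eqrow; split=> // [j|].
  have := col_heightP t j; have := col_heightP t.+1 j; rewrite eqrow => -> {eqrow}.
  by case: ltngtP => //; lia.
have q0 := nth_lam_gt0 tm; have n0 : (0 < n)%N := leq_trans q0 (nth_lam_le _).
by exists (Ordinal n0); rewrite -col_heightP.
Qed.

Lemma distinct_rows_no_gap :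
  ~ (exists i, (2 <= i <= size lam)%N /\ nth 0%N lam i.-1 = nth 0%N lam i.-2) ->
  forall k, (0 < k)%N -> (exists j, (k <= col_height j)%N) -> exists j, col_height j = k.
Proof.
move=> no [//|k] _ [j kj].
have km : (k < size lam)%N by apply: leq_trans kj (count_size _ _).
have q0 := nth_lam_gt0 km.
have lt : (nth 0%N lam k.+1 < nth 0%N lam k)%N.
  have [km1|] := ltnP k.+1 (size lam); last by move=> ?; rewrite [ltnLHS]nth_default.
  rewrite ltn_neqAle; apply/andP; split.
    by apply/eqP => E; apply: no; exists k.+2; rewrite /= km1.
  by apply: nth_lam_noninc.
have jn := leq_trans lt (nth_lam_le _).
exists (Ordinal jn); apply/eqP; rewrite eqn_leq -col_heightP lt andbT.
by rewrite leqNgt -col_heightP /= ltnn.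
Qed.

End Tableaux.

Local Open Scope classical_set_scope.

(** * The braid fan and the permutohedron *)

Section BraidFan.
Variables (R : realType) (n : nat).
Implicit Types (w u x : 'rV[R]_n) (s t : {perm 'I_n}).

(** The closed braid cone that contains w in its relative interior. *)
Definition braid_cone w : set 'rV[R]_n :=
  [set u | forall i j, w 0 i <= w 0 j -> u 0 i <= u 0 j].

(** If u satisfies the weak inequalities, then u + d *: w with a small positive
    d satisfies the strict ones. *)
Lemma closure_braid_cell w : closure (braid_cell w) = braid_cone w.
Proof.
apply/seteqP; split=> u.
  move=> uc i j wij; rewrite leNgt; apply/negP => uji.
  pose e := (u 0 i - u 0 j) / 2.
  have e0 : 0 < e by rewrite divr_gt0 // subr_gt0.
  have [v [vw [_ vu]]] := uc _ (nbhsx_ballx u e e0).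
  have := vu 0 i; have := vu 0 j; rewrite -!ball_normE /= => bj bi.
  have : Num.sg (v 0 i - v 0 j) = 1.
    by apply: gtr0_sg; move: bi bj; rewrite !ltr_norml /e; lra.
  have : w 0 i - w 0 j <= 0 by rewrite subr_le0.
  by rewrite vw -sgr_le0 => + E; rewrite E ler10.
move=> uw B /nbhs_ballP[e /= e0 eB].
pose N : R := 1 + \sum_i `|w 0 i|.
have N0 : 0 < N by rewrite ltr_pwDl // sumr_ge0.
pose d := e / N; have d0 : 0 < d by rewrite divr_gt0.
exists (u + d *: w); split.
  move=> i j; rewrite !mxE.
  have -> : u 0 i + d * w 0 i - (u 0 j + d * w 0 j) = (u 0 i - u 0 j) + d * (w 0 i - w 0 j).
    by ring.
  case: (ltgtP (w 0 i) (w 0 j)) => wij.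
  - have := uw _ _ (ltW wij) => uij; rewrite !ltr0_sg ?subr_lt0 //.
    by rewrite ltr_wnDl ?subr_le0 // pmulr_rlt0 // subr_lt0.
  - have := uw _ _ (ltW wij) => uij; rewrite !gtr0_sg ?subr_gt0 //.
    by rewrite ltr_wpDl ?subr_ge0 // mulr_gt0 // subr_gt0.
  have -> : u 0 i = u 0 j by apply/eqP; rewrite eq_le !uw // wij.
  by rewrite wij !subrr mulr0 addr0.
apply: eB; split=> // i j; rewrite -ball_normE /= ord1 !mxE opprD addNKr normrN normrM gtr0_norm //.
rewrite /d mulrAC ltr_pdivrMr // ltr_pM2l // /N.
have : `|w 0 j| <= \sum_i `|w 0 i| by rewrite (bigD1 j) //= lerDl sumr_ge0.
by lra.
Qed.

Definition vertex s : 'rV[R]_n := \row_i (s i).+1%:R.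

(** The coordinate of u, among i and j, that the vertex s multiplies by the
    larger factor. *)
Definition winner u s i j := if (s j < s i)%N then u 0 i else u 0 j.

Lemma card_below s m : (m <= n)%N -> (\sum_(j | (s j < m)%N) 1 = m)%N.
Proof.
move=> mn; rewrite -[RHS](card_ord m) -sum1_card (big_ord_widen n (fun=> 1%N)) //.
by rewrite [RHS](reindex_inj (@perm_inj _ s)).
Qed.

(** s i counts the j with s j < s i, and i itself accounts for the successor, so
    that the product splits over pairs; comparing it pair by pair with the
    maximum of u 0 i and u 0 j gives the rearrangement inequality together with
    its equality case. *)
Lemma dotp_vertex u s :
  dotp u (vertex s) *+ 2 = \sum_i \sum_j winner u s i j + \sum_i u 0 i.
Proof.
have -> : \sum_i \sum_j winner u s i j =
    \sum_i u 0 i * (s i)%:R + \sum_j u 0 j * (s j).+1%:R.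
  transitivity (\sum_i \sum_(j | (s j < s i)%N) u 0 i + \sum_i \sum_(j | ~~ (s j < s i)%N) u 0 j).
    rewrite -big_split; apply: eq_bigr => i _; rewrite (bigID (fun j => (s j < s i)%N)) /=.
    by congr (_ + _); apply: eq_bigr => j sij; rewrite /winner ?sij // (negbTE sij).
  have cst (P : pred 'I_n) (a : R) : \sum_(j | P j) a = a * (\sum_(j | P j) 1)%N%:R.
    by rewrite natr_sum mulr_sumr; apply: eq_bigr => j _; rewrite mulr1.
  congr (_ + _); first by apply: eq_bigr => i _; rewrite cst card_below // ltnW.
  rewrite (exchange_big_dep predT) //=; apply: eq_bigr => j _.
  rewrite (eq_bigl (fun i => (s i < (s j).+1)%N)) => [|i]; last by rewrite ltnS -leqNgt.
  by rewrite cst card_below.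
rewrite addrAC -big_split /= mulr2n; congr (_ + _); last by apply: eq_bigr => i _; rewrite mxE.
by apply: eq_bigr => i _; rewrite mxE -natr1 mulrDr mulr1.
Qed.

Lemma winner_le u s i j : winner u s i j <= Num.max (u 0 i) (u 0 j).
Proof. by rewrite /winner le_max; case: ifP; rewrite lexx ?orbT. Qed.

Lemma winner_max u s i j : nondecreasing_along s u -> winner u s i j = Num.max (u 0 i) (u 0 j).
Proof.
move=> su; rewrite /winner; case: ltngtP => [/su/max_idPl->//|/su/max_idPr->//|].
by move=> /val_inj/perm_inj->; rewrite maxxx.
Qed.

Lemma vertex_le u s t : nondecreasing_along s u -> dotp u (vertex t) <= dotp u (vertex s).
Proof.
move=> su; rewrite -(ler_pMn2r (n := 2)) // !dotp_vertex lerD2r.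
by apply: ler_sum => i _; apply: ler_sum => j _; rewrite (winner_max _ _ su) winner_le.
Qed.

Lemma vertex_eq u s t : nondecreasing_along s u ->
  dotp u (vertex t) = dotp u (vertex s) -> nondecreasing_along t u.
Proof.
move=> su /(congr1 (fun a => a *+ 2)); rewrite !dotp_vertex => /addIr E i j tij.
rewrite leNgt; apply/negP => uji; have := E; apply/eqP.
rewrite lt_eqF //.
have le2 i' : \sum_j winner u t i' j <= \sum_j winner u s i' j.
  by apply: ler_sum => j' _; rewrite (winner_max _ _ su) winner_le.
rewrite (bigD1 i) //= [ltRHS](bigD1 i) //=; apply: ltr_leD; last by apply: ler_sum.
rewrite (bigD1 j) //= [ltRHS](bigD1 j) //=; apply: ltr_leD.
  by rewrite (winner_max _ _ su) /winner ltnNge (ltnW tij) /= lt_max uji.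
by apply: ler_sum => j' _; rewrite (winner_max _ _ su) winner_le.
Qed.

Lemma dotp_sum u k (c : 'I_k -> R) (p : 'I_k -> 'rV[R]_n) :
  dotp u (\sum_l c l *: p l) = \sum_l c l * dotp u (p l).
Proof.
rewrite /dotp; under [RHS]eq_bigr do rewrite mulr_sumr.
rewrite exchange_big; apply: eq_bigr => i _; rewrite summxE mulr_sumr.
by apply: eq_bigr => l _; rewrite mxE mulrCA.
Qed.

Lemma vertex_in s : permutohedron R n (vertex s).
Proof.
exists 1%N, (fun=> 1), (fun=> vertex s); split=> //; rewrite ?big_ord1 ?scale1r //.
Qed.

Lemma permutohedron_le u s x : nondecreasing_along s u -> permutohedron R n x ->
  dotp u x <= dotp u (vertex s).
Proof.
move=> su [k [c [p [pV c0 c1 ->]]]]; rewrite dotp_sum -[leRHS]mul1r -c1 mulr_suml.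
apply: ler_sum => l _; apply: ler_wpM2l => //.
by have [t _ <-] := pV l; apply: vertex_le.
Qed.

Lemma argmax_vertex u s : nondecreasing_along s u <-> argmax_face (permutohedron R n) u (vertex s).
Proof.
split=> [su|[_ smax]].
  by split=> [|y]; [apply: vertex_in | apply: permutohedron_le].
have [t [tu _]] := order_exists u 1%g.
apply: (vertex_eq tu); apply/eqP; rewrite eq_le vertex_le //=.
by apply: smax; apply: vertex_in.
Qed.

Lemma perm_with i j : i != j -> exists t : {perm 'I_n}, (t i < t j)%N.
Proof.
rewrite -(inj_eq val_inj) neq_ltn => /orP[ij|ij]; first by exists 1%g; rewrite !perm1.
by exists (tperm i j); rewrite tpermL tpermR.
Qed.

(** The vertices in the face of w are the orders compatible with w; they are
    compatible with u exactly when u weakly respects the order of w. *)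
Lemma normal_cone_permutohedron w :
  normal_cone (permutohedron R n) (argmax_face (permutohedron R n) w) = braid_cone w.
Proof.
apply/seteqP; split=> u uN.
  move=> i j wij; have [->//|ij] := eqVneq i j.
  have [t0 t0ij] := perm_with ij; have [t [tw tie]] := order_exists w t0.
  have tij : (t i < t j)%N.
    move: wij; rewrite le_eqVlt => /orP[/eqP/tie->//|]; rewrite ltnNge.
    apply: contraTN; rewrite leq_eqVlt -leNgt => /orP[/eqP/val_inj/perm_inj->//|/tw//].
  by have /argmax_vertex/uN/argmax_vertex := tw; apply.
move=> x [xP xmax]; split=> // y yP.
have [s [sw _]] := order_exists w 1%g.
have su : nondecreasing_along s u by move=> i j /sw/uN.
apply: le_trans (permutohedron_le su yP) _.
have [k [c [p [pV c0 c1 xE]]]] := xP.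
have wx : dotp w x = dotp w (vertex s).
  apply/eqP; rewrite eq_le permutohedron_le //=.
  by apply: xmax; apply: vertex_in.
rewrite xE dotp_sum -[leLHS]mul1r -c1 mulr_suml; apply: ler_sum => l _.
have [->|cl] := eqVneq (c l) 0; first by rewrite !mul0r.
have [t _ tE] := pV l; rewrite -/(vertex t) in tE; rewrite -tE.
apply: ler_wpM2l => //; apply: vertex_le.
suff tw : nondecreasing_along t w by move=> i j /tw/uN.
apply: (vertex_eq sw); apply/eqP; rewrite eq_le vertex_le //=.
move: wx; rewrite xE dotp_sum -[RHS]mul1r -c1 mulr_suml (bigD1 l) //= [RHS](bigD1 l) //=.
have cl0 : 0 < c l by rewrite lt_def cl c0.
rewrite -tE => E; rewrite -(ler_pM2l cl0).
have : \sum_(i | i != l) c i * dotp w (p i) <= \sum_(i | i != l) c i * dotp w (vertex s).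
  by apply: ler_sum => i _; apply: ler_wpM2l => //; have [t' _ <-] := pV i; apply: vertex_le.
by lra.
Qed.

Lemma normal_fan_permutohedron : normal_fan (permutohedron R n) = braid_fan R n.
Proof.
apply/seteqP; split=> C.
  by move=> [F [w ->] <-]; exists w; rewrite // closure_braid_cell normal_cone_permutohedron.
move=> [w _ <-]; exists (argmax_face (permutohedron R n) w); first by exists w.
by rewrite closure_braid_cell normal_cone_permutohedron.
Qed.

Lemma permutohedron_polytope : polytope (permutohedron R n).
Proof.
exists [set \row_i (s i).+1%:R | s in [set: {perm 'I_n}]]; split=> //.
  exact/finite_image/finite_finset.
by exists (vertex 1%g), 1%g.
Qed.

End BraidFan.

(** * Groebner cells *)

Section Cells.
Variables (R : realType) (K : fieldType) (n : nat) (beta : 'I_n -> nat).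
Variable I : set (mpoly n K).
Implicit Types (w u : 'rV[R]_n) (s : {perm 'I_n}) (c : 'I_n -> 'I_n).
Hypothesis I_ideal : is_ideal I.
Hypothesis I_vdm : forall c, dominated (class_size c) beta -> I (vdm K c).
Hypothesis I_vanish : forall f (a : 'I_n -> {poly K}) (v : nat -> {poly K}),
  I f -> injective v -> mmap (@polyC K) a f != 0 ->
  forall k, (\sum_(l < k) \sum_x (a x == v l) <= cap beta k)%N.

Local Notation J w := (@initial_gen R K n beta w).

Lemma groebner_cellE w w' : groebner_cell I w w' <-> J w = J w'.
Proof. by rewrite /groebner_cell /= !(initial_ideal_gen I_ideal I_vdm I_vanish). Qed.

Lemma braid_cell_lt w w' x y : braid_cell w w' -> (w' 0 x < w' 0 y) = (w 0 x < w 0 y).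
Proof.
move=> ww'; rewrite -(subr_lt0 (w' 0 y)) -(subr_lt0 (w 0 y)).
by rewrite -sgr_lt0 ww' sgr_lt0.
Qed.

(** Initial forms of differences only depend on the signs of w 0 x - w 0 y. *)
Lemma braid_cell_sub w : braid_cell w `<=` groebner_cell I w.
Proof.
move=> w' ww'; apply/groebner_cellE; congr ideal_gen.
suff E c : init_prod K w (fun x y => (x < y)%N) c = init_prod K w' (fun x y => (x < y)%N) c.
  by apply/seteqP; split=> g [c [cb ->]]; exists c; rewrite E.
apply: eq_bigr => x _; apply: eq_bigr => y _.
by rewrite /init_pair !(braid_cell_lt _ _ ww').
Qed.

Lemma braid_fan_refines : refines (braid_fan R n) (groebner_fan R I).
Proof.
split.
  apply/seteqP; split=> w _.
    by exists (closure (groebner_cell I w)); [exists w | exact: subset_closure].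
  by exists (closure (braid_cell w)); [exists w | exact: subset_closure].
move=> C [w _ <-]; exists (closure (groebner_cell I w)); split; first by exists w.
exact/closure_subset/braid_cell_sub.
Qed.

Lemma adjacent_inversion s s' a b : (s b < s a)%N -> (s' a < s' b)%N ->
  exists a1 b1, (s b1).+1 = s a1 :> nat /\ (s' a1 < s' b1)%N.
Proof.
move=> sba s'ab; apply: contrapT => no.
pose at_rank k (kn : (k < n)%N) := (s^-1)%g (Ordinal kn).
have mono d : forall x y, (s x + d.+1 = s y)%N -> (s' x < s' y)%N.
  elim: d => [|d IH] x y xy.
    rewrite ltn_neqAle leqNgt; apply/andP; split.
      by rewrite (inj_eq val_inj) (inj_eq perm_inj); apply/eqP => E; rewrite E in xy; lia.
    by apply/negP => s'yx; apply: no; exists y, x; split=> //; lia.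
  have zn : (s x + d.+1 < n)%N by have := ltn_ord (s y); lia.
  pose z := at_rank _ zn; have sz : s z = (s x + d.+1)%N :> nat by rewrite permKV.
  apply: (ltn_trans (IH x z _)); first by rewrite sz.
  rewrite ltn_neqAle leqNgt; apply/andP; split.
    by rewrite (inj_eq val_inj) (inj_eq perm_inj); apply/eqP => E; rewrite E in sz; lia.
  by apply/negP => s'yz; apply: no; exists y, z; split=> //; lia.
by have := mono (s a - (s b).+1)%N b a; rewrite addnS -addSn subnKC // => /(_ erefl); lia.
Qed.

Section Gap.
Hypothesis sum_beta : (\sum_j beta j = n)%N.
Hypothesis beta_mono : forall i j : 'I_n, (i <= j)%N -> (beta j <= beta i)%N.
Variable t : nat.
Hypotheses (t_gt0 : (0 < t)%N) (t_gap : forall j, beta j != t).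
Hypothesis t_lt : exists j, (t < beta j)%N.

(** Otherwise two orders compatible with w and w' have the same standard
    monomials but invert a pair, so by convexity some neighbours can be exchanged
    without changing the standard monomials, which gap_detects excludes. *)
Lemma gap_no_inversion w w' a b : J w = J w' -> w 0 b < w 0 a -> w' 0 b < w' 0 a.
Proof.
move=> ww' wba; rewrite ltNge; apply/negP => w'ab.
have ab : a != b by apply: contraTneq wba => ->; rewrite ltxx.
have [t0 t0ab] := perm_with ab.
have [s' [s'w' s'tie]] := order_exists w' t0.
have [s [sw stie]] := order_exists w s'.
have s'ab : (s' a < s' b)%N.
  move: w'ab; rewrite le_eqVlt => /orP[/eqP/s'tie->//|]; rewrite ltNge.
  by apply: contraTT; rewrite -leqNgt leq_eqVlt => /orP[/eqP/val_inj/perm_inj E|/s'w'->//];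
    rewrite E eqxx in ab.
have sba : (s b < s a)%N.
  move: wba; rewrite ltNge; apply: contraR.
  by rewrite -leqNgt leq_eqVlt => /orP[/eqP/val_inj/perm_inj->//|/sw].
have ss' := initial_gen_reducible I_ideal I_vdm I_vanish ww' sw s'w' stie.
have [a1 [b1 [sab1 s'ab1]]] := adjacent_inversion sba s'ab.
have s3s := swap_reducible R I_ideal I_vdm I_vanish sab1 s'ab1 ss'.
have ss3 := reducible_sym R I_ideal I_vdm I_vanish s3s.
have [c [cb cmax]] := gap_detects sum_beta beta_mono t_gt0 t_gap t_lt sab1.
have red : reducible beta s (lead_exp s c).
  by exists c; split=> // x; rewrite lead_expE.
have [c' gc'] := greedy_exists (tperm a1 b1 * s)%g (lead_exp s c).
apply: (cmax c'); last exact: reducible_greedy gc' (ss3 _ red).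
move=> x; have := gc' x; rewrite /greedy_at lead_expE; apply.
Qed.

Lemma gap_groebner_cell w : groebner_cell I w = braid_cell w.
Proof.
apply/seteqP; split; last exact: braid_cell_sub.
move=> w' /groebner_cellE ww' i j.
case: (ltgtP (w 0 i) (w 0 j)) => wij.
- by have := gap_no_inversion ww' wij; move=> w'ij; rewrite !ltr0_sg ?subr_lt0.
- by have := gap_no_inversion ww' wij; move=> w'ij; rewrite !gtr0_sg ?subr_gt0.
have -> : w' 0 i = w' 0 j.
  case: (ltgtP (w' 0 i) (w' 0 j)) => // w'ij;
    by have := gap_no_inversion (esym ww') w'ij; rewrite wij ltxx.
by rewrite wij !subrr.
Qed.

Lemma gap_groebner_fan : groebner_fan R I = braid_fan R n.
Proof.
by apply/seteqP; split=> C [w _ <-]; exists w; rewrite // gap_groebner_cell.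
Qed.

End Gap.

Lemma init_prod_increasing s w c : increasing_along s w ->
  init_prod K w (fun y x => (s y < s x)%N) c = mpolyX K (lead_exp s c).
Proof.
move=> sw; have [_ <-] := initial_part_oprod K w (fun y x => (s y < s x)%N) c.
rewrite (top_weight_lead c (increasing_nondecreasing sw)) -/(vdm_along K s c).
rewrite -[vdm_along K s c](subrK (mpolyX K (lead_exp s c))) componentD component_low.
  by rewrite add0r component_id //; apply: supportedX.
by apply: (supported_sub _ (@vdm_along_leads R K n s c)) => m [_]; apply.
Qed.

Section NoGapCells.
Hypothesis sum_beta : (\sum_j beta j = n)%N.
Hypothesis nogap :
  forall k, (0 < k)%N -> (exists j, (k <= beta j)%N) -> exists j, beta j = k.

Lemma no_gap_initial_gen s a b w w' : (s b).+1 = s a :> nat -> (s a).+1 = n ->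
  increasing_along s w -> increasing_along (tperm a b * s)%g w' -> J w `<=` J w'.
Proof.
move=> sab san sw s3w'; have J'i := initial_gen_ideal K beta w'.
apply: ideal_gen_min => // g [c [cb ->]].
have [c3 [c3b c3le]] := no_gap_swap sab san sum_beta nogap cb.
suff Jc : J w' (init_prod K w (fun y x => (s y < s x)%N) c).
  have [<-//|E] := init_prod_sign K w s c.
  by rewrite -[init_prod K w _ c]opprK -E; apply: idealN.
rewrite (init_prod_increasing c sw).
have -> : lead_exp s c = mnm_add (mnm_sub (lead_exp s c) (lead_exp (tperm a b * s)%g c3))
    (lead_exp (tperm a b * s)%g c3).
  by apply/mnmP => x; rewrite mnmDE mnmBE subnK // !lead_expE.
rewrite mpolyXD -(init_prod_increasing c3 s3w'); case: J'i => _ _; apply.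
exact: init_prod_in.
Qed.

(** Exchanging the two largest variables does not change the initial ideal, so one
    Groebner cell meets two open chambers of the braid arrangement. *)
Lemma no_gap_groebner_fan : (2 <= n)%N -> groebner_fan R I <> braid_fan R n.
Proof.
move=> n2 fanE; have [n1 n0] : (n.-1 < n)%N /\ (n.-2 < n)%N by lia.
pose a := Ordinal n1; pose b := Ordinal n0.
pose s : {perm 'I_n} := 1%g; pose s3 := (tperm a b * s)%g.
have sab : (s b).+1 = s a :> nat by rewrite !perm1 /=; lia.
have san : (s a).+1 = n by rewrite perm1 /=; lia.
have s3b : s3 b = a by rewrite permM tpermR perm1.
have s3a : s3 a = b by rewrite permM tpermL perm1.
pose w : 'rV[R]_n := rank_row R s; pose w3 : 'rV[R]_n := rank_row R s3.
have JJ : J w = J w3.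
  apply/seteqP; split.
    by apply: (no_gap_initial_gen sab san); apply: rank_row_increasing.
  apply: (@no_gap_initial_gen s3 b a); rewrite ?s3a ?s3b.
  - by have := sab; rewrite !perm1.
  - by have := san; rewrite perm1.
  - exact: rank_row_increasing.
  by rewrite mulgA [tperm b a]tpermC tperm2 mul1g; apply: rank_row_increasing.
have : groebner_fan R I (closure (groebner_cell I w)) by exists w.
rewrite fanE => -[u _]; rewrite closure_braid_cell => uE.
have uw : braid_cone u w by rewrite uE; apply: subset_closure; apply/groebner_cellE.
have uw3 : braid_cone u w3 by rewrite uE; apply: subset_closure; apply/groebner_cellE.
have [/uw|/ltW/uw3] := leP (u 0 a) (u 0 b); rewrite !mxE ler_nat.
  by rewrite !perm1 /=; lia.
by rewrite s3a s3b /=; lia.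
Qed.

End NoGapCells.
End Cells.

Theorem theorem3p5 (R : realType) (K : fieldType) (n : nat) (lam : seq nat)
    (n_gt0 : (0 < n)%N)
    (lam_noninc : sorted geq lam)
    (lam_sum : sumn lam = n)
    (lam_size : (2 <= size lam)%N)
    (lam_last : (0 < last 0 lam)%N) :
  (forall P : set 'rV[R]_n,
     state_polytope (specht_ideal K n lam) P -> generalized_permutohedron P) /\
  (state_polytope (specht_ideal K n lam) (permutohedron R n) <->
   exists i : nat,
     (2 <= i <= size lam)%N /\ nth 0%N lam i.-1 = nth 0%N lam i.-2).
Proof.
have Ii := specht_ideal_ideal K n lam.
have Iv := @specht_ideal_vdm K n lam lam_noninc lam_sum.
have Iz := @specht_ideal_vanish K n lam lam_sum.
have sum_beta := sum_col_height lam_sum.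
split=> [P [Ppoly fanE]|].
  by split=> //; rewrite -fanE; apply: braid_fan_refines Ii Iv Iz.
split=> [[_ fanE]|[i [im eqrow]]].
  apply: contrapT => no; apply: (@no_gap_groebner_fan R K n _ _ Ii Iv Iz sum_beta).
  - exact: distinct_rows_no_gap.
  - have := nth_lam_gt0 lam_noninc lam_last lam_size.
    have := nth_lam_gt0 lam_noninc lam_last (ltnW lam_size).
    by rewrite -lam_sum; case: (lam) => [//|x [//|y r]] /=; lia.
  - by rewrite fanE normal_fan_permutohedron.
have [t0 tgap tlt] := equal_rows_gap lam_noninc lam_sum lam_last im eqrow.
split; first exact: permutohedron_polytope.
rewrite normal_fan_permutohedron.
by apply: (gap_groebner_fan R Ii Iv Iz sum_beta _ t0 tgap tlt) => i' j; apply: col_height_mono.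
Qed.
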